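(* Let $f=h+\overline{g}$ be a harmonic mapping in $\mathbb{D}$ such that either $h$ or $g$ is bounded. Then $f$ is normal in $\mathbb{D}$ if and only if for each pair of sequences $\{z_n\}$ and $\{w_n\}$ of points of $\mathbb{D}$ such that $\rho(z_n,w_n)\to 0$ as $n\to\infty$, the convergence of $\{f(z_n)\}$ implies the convergence of $\{f(w_n)\}$ with the same limit.
   Context: $\mathbb{D}=\{z\in\mathbb{C}:|z|<1\}$. A harmonic mapping in $\mathbb{D}$ is a complex-valued harmonic function $f$ with canonical decomposition $f=h+\overline{g}$, where $h,g$ are analytic in $\mathbb{D}$. Put $$f^{\#}(z)=\frac{|h'(z)|+|g'(z)|}{1+|f(z)|^2}.$$ A harmonic mapping $f$ in $\mathbb{D}$ is called normal if $\sup_{z\in\mathbb{D}}(1-|z|^2)f^{\#}(z)<\infty$. The hyperbolic distance in $\mathbb{D}$ is $$\rho(z_1,z_2)=\frac12\log\frac{1+r}{1-r},\qquad r=\left|\frac{z_1-z_2}{1-\overline{z_1}z_2}\right|.$$ *)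

(* Defs.v *)
From Stdlib Require Import Reals.
From Coquelicot Require Import Coquelicot.
Open Scope R_scope.

Definition in_disc (z : C) : Prop := Cmod z < 1.

(* Complex differentiability: the scalar field is C, not R. *)
Definition analytic_in_disc (h : C -> C) : Prop :=
  forall z : C, in_disc z -> @ex_derive C_AbsRing C_NormedModule h z.

Definition bounded_in_disc (h : C -> C) : Prop :=
  exists M : R, forall z : C, in_disc z -> Cmod (h z) <= M.

(* f is the harmonic mapping of the disc with canonical decomposition
   f = h + conj g.  Functions are total on C; values off the disc are
   irrelevant. *)
Definition harmonic_mapping (f h g : C -> C) : Prop :=
  analytic_in_disc h /\ analytic_in_disc g /\
  forall z : C, in_disc z -> f z = Cplus (h z) (Cconj (g z)).

(* C_derive h z is a limit of difference quotients along the real direction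
   only; where h is complex differentiable it is the complex derivative
   (C_derive_correct). *)
Definition fsharp (f h g : C -> C) (z : C) : R :=
  (Cmod (C_derive h z) + Cmod (C_derive g z)) / (1 + (Cmod (f z)) ^ 2).

Definition normal_in_disc (f h g : C -> C) : Prop :=
  Rbar_lt
    (Lub_Rbar (fun x : R => exists z : C,
       in_disc z /\ x = (1 - (Cmod z) ^ 2) * fsharp f h g z))
    p_infty.

Definition pseudo_hyp (z1 z2 : C) : R :=
  Cmod (Cdiv (Cminus z1 z2) (Cminus (RtoC 1) (Cmult (Cconj z1) z2))).

Definition hyp_dist (z1 z2 : C) : R :=
  / 2 * ln ((1 + pseudo_hyp z1 z2) / (1 - pseudo_hyp z1 z2)).

Definition C_seq_lim (u : nat -> C) (l : C) : Prop :=
  filterlim u eventually (locally l).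

(* Main.v *)
Require Import Defs.
From Stdlib Require Import Reals Lra Lia Classical IndefiniteDescription.
From Coquelicot Require Import Coquelicot.
Open Scope R_scope.

(** If [f] is normal, [f] is Lipschitz from the hyperbolic metric to the
    chordal one, which a finite limit turns into convergence in the plane.
    Conversely, by compactness of the closed ball of radius [B], the sequential
    condition gives [delta > 0] such that [|f z| <= B] implies [|f| <= B + 1]
    on the pseudo-hyperbolic disc of radius [delta] around [z].  Let [g] be
    bounded by [M].  Where [f] is small, [h] is thus bounded on a disc of radius
    comparable to [1 - |z|]; where [f] is large, [1/h] is bounded by [1] on such
    a disc.  In both cases Cauchy's estimate bounds [(1 - |z|^2) f^# (z)]. *)

(** Analyticity is bare complex differentiability at each point, without continuity of the
    derivative, so Cauchy's estimate has to rest on Goursat's bisection argument. Only rectangles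
    with sides parallel to the axes are integrated over: an exponential coordinate turns circles
    around a point into vertical segments. The sequential condition says nothing where [f] tends to
    infinity. This is why the uniform statement supposes [|f z| <= B], and why large values are
    reached by exchanging the two points: if [|f w| <= M + 1] at a nearby [w], then
    [|f z| <= M + 2]. Boundedness of [g] enters because [|f|] and [|h|] then differ by at most [M];
    so [h] has no zero near a point with [|f z| > M + 2], and [1/h] is analytic there. *)

(** * Complex differentiability in epsilon-delta form, and continuity along segments *)

(** On the side of the argument, [is_derive] uses the uniform structure of [C_AbsRing], whose balls
    are the discs of [Cmod]; both directions are little more than unfolding. *)
Lemma is_derive_C_iff (h : C -> C) (z d : C) :
  @is_derive C_AbsRing C_NormedModule h z d <->
  (forall eps : R, 0 < eps -> exists delta : R, 0 < delta /\
     forall w : C, Cmod (w - z) < delta ->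
       Cmod (h w - h z - (w - z) * d) <= eps * Cmod (w - z)).
Proof.
split.
- intros [_ H] eps Heps.
  destruct (H z (fun P HP => HP) (mkposreal eps Heps)) as [delta Hd].
  exists delta; split; [apply cond_pos|].
  intros w Hw; exact (Hd w Hw).
- intros H; split; [apply is_linear_scal_l|].
  intros x Hx.
  rewrite <- (is_filter_lim_locally_unique _ _ Hx).
  intros eps.
  destruct (H eps (cond_pos eps)) as [delta [Hd Hw]].
  exists (mkposreal delta Hd); intros w Hb; exact (Hw w Hb).
Qed.

Lemma Im_le_Cmod (z : C) : Rabs (Im z) <= Cmod z.
Proof.
generalize (Rmax_Cmod z); intros H.
eapply Rle_trans; [apply Rmax_r|exact H].
Qed.

Lemma Cmod_le_Rabs (z : C) : Cmod z <= Rabs (Re z) + Rabs (Im z).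
Proof.
destruct z as [x y]; simpl.
replace (x, y) with (Cplus (RtoC x) (Cmult Ci (RtoC y)))
  by (unfold Cplus, Cmult, Ci, RtoC; simpl; f_equal; ring).
eapply Rle_trans; [apply Cmod_triangle|].
rewrite Cmod_mult, Cmod_Ci, !Cmod_R; lra.
Qed.

Lemma C_derivable_continuity (H : C -> C) (z d : C) :
  @is_derive C_AbsRing C_NormedModule H z d ->
  forall eps : R, 0 < eps -> exists delta : R, 0 < delta /\
    forall w : C, Cmod (w - z) < delta -> Cmod (H w - H z) < eps.
Proof.
intros Hd eps Heps.
destruct (proj1 (is_derive_C_iff H z d) Hd 1 Rlt_0_1) as [delta [H0 H1]].
pose proof (Cmod_ge_0 d) as Hd0.
assert (H2 : 0 < eps / (2 + Cmod d)) by (apply Rdiv_lt_0_compat; lra).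
exists (Rmin delta (eps / (2 + Cmod d))); split; [now apply Rmin_glb_lt|].
intros w Hw.
pose proof (H1 w (Rlt_le_trans _ _ _ Hw (Rmin_l _ _))) as H3.
pose proof (Rlt_le_trans _ _ _ Hw (Rmin_r _ _)) as H4.
replace (H w - H z)%C with ((H w - H z - (w - z) * d) + (w - z) * d)%C by ring.
eapply Rle_lt_trans; [apply Cmod_triangle|]; rewrite Cmod_mult.
apply Rle_lt_trans with (Cmod (w - z) * (1 + Cmod d)); [lra|].
apply Rlt_le_trans with (eps / (2 + Cmod d) * (2 + Cmod d)).
- pose proof (Cmod_ge_0 (w - z)); nra.
- right; field; lra.
Qed.

(** Used with [p] a parametrised side of a rectangle and [q] the real or imaginary part, to
    integrate along that side. *)
Lemma continuity_pt_along (H : C -> C) (d : C) (p : R -> C) (q : C -> R) (t : R) :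
  @is_derive C_AbsRing C_NormedModule H (p t) d ->
  (forall s : R, Cmod (p s - p t) <= Rabs (s - t)) ->
  (forall z w : C, Rabs (q z - q w) <= Cmod (z - w)) ->
  continuous (fun s => q (H (p s))) t.
Proof.
intros Hd Hp Hq.
apply filterlim_locally; intros eps.
destruct (C_derivable_continuity H _ _ Hd eps (cond_pos eps)) as [delta [H0 H1]].
exists (mkposreal delta H0); intros s Hs.
change (Rabs (q (H (p s)) - q (H (p t))) < eps).
change (Rabs (s - t) < delta) in Hs.
eapply Rle_lt_trans; [apply Hq|]; apply H1.
eapply Rle_lt_trans; [apply Hp|exact Hs].
Qed.

Lemma Re_dist (z w : C) : Rabs (Re z - Re w) <= Cmod (z - w).
Proof. exact (re_le_Cmod (z - w)). Qed.

Lemma Im_dist (z w : C) : Rabs (Im z - Im w) <= Cmod (z - w).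
Proof. exact (Im_le_Cmod (z - w)). Qed.

Lemma horizontal_dist (y s t : R) : Cmod ((s, y) - (t, y)) <= Rabs (s - t).
Proof.
eapply Rle_trans; [apply Cmod_le_Rabs|]; simpl.
replace (y + - y) with 0 by ring; rewrite Rabs_R0; unfold Rminus; lra.
Qed.

Lemma vertical_dist (x s t : R) : Cmod ((x, s) - (x, t)) <= Rabs (s - t).
Proof.
eapply Rle_trans; [apply Cmod_le_Rabs|]; simpl.
replace (x + - x) with 0 by ring; rewrite Rabs_R0; unfold Rminus; lra.
Qed.

(** * Goursat's theorem on rectangles *)

Definition C_derivable_on (H : C -> C) (D : C -> Prop) : Prop :=
  forall z : C, D z -> exists d : C, @is_derive C_AbsRing C_NormedModule H z d.

Definition rectangle (a b c d : R) (z : C) : Prop :=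
  a <= Re z <= b /\ c <= Im z <= d.

(* Integral of the real part of [H dz] along the positively oriented boundary. *)
Definition circulation (H : C -> C) (a b c d : R) : R :=
  RInt (fun x => Re (H (x, c)) - Re (H (x, d))) a b +
  RInt (fun y => Im (H (a, y)) - Im (H (b, y))) c d.

Section Rectangle.

Variables (H : C -> C) (a b c d : R).
Hypothesis Hab : a <= b.
Hypothesis Hcd : c <= d.
Hypothesis Hdiff : C_derivable_on H (rectangle a b c d).

Lemma ex_RInt_horizontal (y s t : R) :
  c <= y <= d -> a <= s -> s <= t -> t <= b ->
  ex_RInt (fun x => Re (H (x, y))) s t.
Proof.
intros Hy Hs Hst Ht.
apply (ex_RInt_continuous (V := R_CompleteNormedModule)).
rewrite Rmin_left, Rmax_right by lra; intros x Hx.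
destruct (Hdiff (x, y)) as [e He]; [unfold rectangle; simpl; lra|].
apply (continuity_pt_along H e (fun s => (s, y))); auto.
- intros; apply horizontal_dist.
- exact Re_dist.
Qed.

Lemma ex_RInt_vertical (x s t : R) :
  a <= x <= b -> c <= s -> s <= t -> t <= d ->
  ex_RInt (fun y => Im (H (x, y))) s t.
Proof.
intros Hx Hs Hst Ht.
apply (ex_RInt_continuous (V := R_CompleteNormedModule)).
rewrite Rmin_left, Rmax_right by lra; intros y Hy.
destruct (Hdiff (x, y)) as [e He]; [unfold rectangle; simpl; lra|].
apply (continuity_pt_along H e (fun s => (x, s))); auto.
- intros; apply vertical_dist.
- exact Im_dist.
Qed.

Lemma ex_RInt_horizontals (s t : R) :
  a <= s -> s <= t -> t <= b ->
  ex_RInt (fun x => Re (H (x, c)) - Re (H (x, d))) s t.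
Proof.
intros; apply (ex_RInt_minus (V := R_NormedModule));
  apply ex_RInt_horizontal; lra.
Qed.

Lemma ex_RInt_verticals (x x' s t : R) :
  a <= x <= b -> a <= x' <= b -> c <= s -> s <= t -> t <= d ->
  ex_RInt (fun y => Im (H (x, y)) - Im (H (x', y))) s t.
Proof.
intros; apply (ex_RInt_minus (V := R_NormedModule));
  apply ex_RInt_vertical; lra.
Qed.

(** The common side [x = m] is traversed in opposite directions by the two halves, so its
    contributions cancel. *)
Lemma circulation_split_x (m : R) : a <= m <= b ->
  circulation H a b c d = circulation H a m c d + circulation H m b c d.
Proof.
intros Hm; unfold circulation.
rewrite <- (RInt_Chasles (V := R_CompleteNormedModule) _ a m b)
  by (apply ex_RInt_horizontals; lra).
assert (E : RInt (fun y => Im (H (a, y)) - Im (H (b, y))) c d =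
  RInt (fun y => Im (H (a, y)) - Im (H (m, y))) c d +
  RInt (fun y => Im (H (m, y)) - Im (H (b, y))) c d).
{ etransitivity.
  2: apply (RInt_plus (V := R_CompleteNormedModule)); apply ex_RInt_verticals; lra.
  apply RInt_ext; intros y _; unfold plus; simpl; ring. }
rewrite E; unfold plus; simpl; ring.
Qed.

Lemma circulation_split_y (m : R) : c <= m <= d ->
  circulation H a b c d = circulation H a b c m + circulation H a b m d.
Proof.
intros Hm; unfold circulation.
rewrite <- (RInt_Chasles (V := R_CompleteNormedModule) _ c m d)
  by (apply ex_RInt_verticals; lra).
assert (E : RInt (fun x => Re (H (x, c)) - Re (H (x, d))) a b =
  RInt (fun x => Re (H (x, c)) - Re (H (x, m))) a b +
  RInt (fun x => Re (H (x, m)) - Re (H (x, d))) a b).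
{ etransitivity.
  2: apply (RInt_plus (V := R_CompleteNormedModule));
     apply (ex_RInt_minus (V := R_NormedModule)); apply ex_RInt_horizontal; lra.
  apply RInt_ext; intros y _; unfold plus; simpl; ring. }
rewrite E; unfold plus; simpl; ring.
Qed.

(** The affine function [H p + (z - p) * e] has circulation zero: with [q = Im e], its horizontal
    sides give [(b - a) * q * (d - c)] and its vertical sides the opposite. Only the error term is
    left. It is at most [eta * D] at each point of the boundary, and each of the two integrands is a
    difference of two such terms. *)
Lemma circulation_local (p e : C) (eta : R) :
  0 <= eta ->
  rectangle a b c d p ->
  (forall z : C, rectangle a b c d z ->
     Cmod (H z - H p - (z - p) * e) <= eta * Cmod (z - p)) ->
  Rabs (circulation H a b c d) <= 2 * eta * ((b - a) + (d - c)) ^ 2.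
Proof.
intros Heta Hp Hloc.
set (D := (b - a) + (d - c)).
assert (HD : forall z, rectangle a b c d z ->
  Cmod (H z - H p - (z - p) * e) <= eta * D).
{ intros z Hz; eapply Rle_trans; [apply Hloc, Hz|].
  apply Rmult_le_compat_l; [exact Heta|].
  eapply Rle_trans; [apply Cmod_le_Rabs|].
  destruct z as [x y], p as [x' y']; unfold rectangle, D in *; simpl in *.
  apply Rplus_le_compat; apply Rabs_le; lra. }
set (q := Im e).
assert (Hx : forall x, a <= x <= b ->
  Rabs (Re (H (x, c)) - Re (H (x, d)) - q * (d - c)) <= 2 * (eta * D)).
{ intros x Hx.
  assert (B1 := HD (x, c)); assert (B2 := HD (x, d)).
  unfold rectangle in B1, B2; simpl in B1, B2.
  specialize (B1 ltac:(lra)); specialize (B2 ltac:(lra)).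
  apply (Rle_trans _ _ _ (re_le_Cmod _)) in B1, B2.
  replace (Re (H (x, c)) - Re (H (x, d)) - q * (d - c)) with
    (Re (H (x, c) - H p - ((x, c) - p) * e)
     - Re (H (x, d) - H p - ((x, d) - p) * e))
    by (unfold q, Re, Im; destruct p, e; simpl; ring).
  eapply Rle_trans; [apply Rabs_triang|]; rewrite Rabs_Ropp; lra. }
assert (Hy : forall y, c <= y <= d ->
  Rabs (Im (H (a, y)) - Im (H (b, y)) - q * (a - b)) <= 2 * (eta * D)).
{ intros y Hy.
  assert (B1 := HD (a, y)); assert (B2 := HD (b, y)).
  unfold rectangle in B1, B2; simpl in B1, B2.
  specialize (B1 ltac:(lra)); specialize (B2 ltac:(lra)).
  apply (Rle_trans _ _ _ (Im_le_Cmod _)) in B1, B2.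
  replace (Im (H (a, y)) - Im (H (b, y)) - q * (a - b)) with
    (Im (H (a, y) - H p - ((a, y) - p) * e)
     - Im (H (b, y) - H p - ((b, y) - p) * e))
    by (unfold q, Re, Im; destruct p, e; simpl; ring).
  eapply Rle_trans; [apply Rabs_triang|]; rewrite Rabs_Ropp; lra. }
assert (I1 : is_RInt (fun x => minus (Re (H (x, c)) - Re (H (x, d))) (q * (d - c))) a b
  (minus (RInt (fun x => Re (H (x, c)) - Re (H (x, d))) a b) (scal (b - a) (q * (d - c))))).
{ apply (is_RInt_minus (V := R_NormedModule)).
  - apply (RInt_correct (V := R_CompleteNormedModule)), ex_RInt_horizontals; lra.
  - apply (is_RInt_const (V := R_NormedModule)). }
assert (I2 : is_RInt (fun y => minus (Im (H (a, y)) - Im (H (b, y))) (q * (a - b))) c d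
  (minus (RInt (fun y => Im (H (a, y)) - Im (H (b, y))) c d) (scal (d - c) (q * (a - b))))).
{ apply (is_RInt_minus (V := R_NormedModule)).
  - apply (RInt_correct (V := R_CompleteNormedModule)), ex_RInt_verticals; lra.
  - apply (is_RInt_const (V := R_NormedModule)). }
apply (norm_RInt_le_const (V := R_NormedModule) _ _ _ _ (2 * (eta * D)) Hab) in I1;
  [|exact Hx].
apply (norm_RInt_le_const (V := R_NormedModule) _ _ _ _ (2 * (eta * D)) Hcd) in I2;
  [|exact Hy].
change norm with Rabs in I1, I2; simpl in I1, I2.
unfold minus, plus, opp, scal in I1, I2; simpl in I1, I2; unfold mult in I1, I2; simpl in I1, I2.
unfold circulation.
match goal with |- Rabs (?u + ?v) <= _ =>
  replace (u + v) with ((u + - ((b - a) * (q * (d - c)))) + (v + - ((d - c) * (q * (a - b)))))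
  by ring end.
eapply Rle_trans; [apply Rabs_triang|].
eapply Rle_trans; [apply Rplus_le_compat; [exact I1|exact I2]|].
right; unfold D; ring.
Qed.

End Rectangle.

Lemma rectangle_sub (H : C -> C) (a b c d a' b' c' d' : R) :
  a <= a' -> b' <= b -> c <= c' -> d' <= d ->
  C_derivable_on H (rectangle a b c d) ->
  C_derivable_on H (rectangle a' b' c' d').
Proof. intros ? ? ? ? Hd z [Hz Hz']; apply Hd; split; lra. Qed.

Lemma Rabs_half_choice (x y : R) :
  Rabs (x + y) / 2 <= Rabs x \/ Rabs (x + y) / 2 <= Rabs y.
Proof.
pose proof (Rabs_triang x y).
destruct (Rle_lt_dec (Rabs (x + y) / 2) (Rabs x)); [left|right]; lra.
Qed.

(** Halving in [x] and then in [y] retains at least half of the circulation each time, hence a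
    quarter in all. *)
Lemma circulation_bisect (H : C -> C) (a b c d : R) :
  a <= b -> c <= d -> C_derivable_on H (rectangle a b c d) ->
  exists a' b' c' d' : R,
    a <= a' /\ b' <= b /\ c <= c' /\ d' <= d /\
    b' - a' = (b - a) / 2 /\ d' - c' = (d - c) / 2 /\
    Rabs (circulation H a b c d) / 4 <= Rabs (circulation H a' b' c' d').
Proof.
intros Hab Hcd Hd.
assert (X : exists a' b', a <= a' /\ b' <= b /\ b' - a' = (b - a) / 2 /\
  Rabs (circulation H a b c d) / 2 <= Rabs (circulation H a' b' c d)).
{ rewrite (circulation_split_x H a b c d Hab Hcd Hd ((a + b) / 2)) by lra.
  destruct (Rabs_half_choice (circulation H a ((a + b) / 2) c d)
    (circulation H ((a + b) / 2) b c d)) as [E|E].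
  - exists a, ((a + b) / 2); repeat split; lra.
  - exists ((a + b) / 2), b; repeat split; lra. }
destruct X as (a' & b' & Ha & Hb & Hab' & E).
assert (Hd' : C_derivable_on H (rectangle a' b' c d))
  by (apply (rectangle_sub H a b c d); auto; lra).
rewrite (circulation_split_y H a' b' c d ltac:(lra) Hcd Hd' ((c + d) / 2)) in E by lra.
destruct (Rabs_half_choice (circulation H a' b' c ((c + d) / 2))
    (circulation H a' b' ((c + d) / 2) d)) as [F|F].
- exists a', b', c, ((c + d) / 2); repeat split; lra.
- exists a', b', ((c + d) / 2), d; repeat split; lra.
Qed.

Lemma nested_intervals (a b : nat -> R) :
  (forall n, a n <= a (S n)) -> (forall n, b (S n) <= b n) ->
  (forall n, a n <= b n) ->
  exists p, forall n, a n <= p <= b n.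
Proof.
intros Ha Hb Hab.
assert (Ma : forall n k, a n <= a (n + k)%nat).
{ intros n k; induction k; [rewrite Nat.add_0_r; lra|].
  rewrite Nat.add_succ_r; eapply Rle_trans; [exact IHk|apply Ha]. }
assert (Mb : forall n k, b (n + k)%nat <= b n).
{ intros n k; induction k; [rewrite Nat.add_0_r; lra|].
  rewrite Nat.add_succ_r; eapply Rle_trans; [apply Hb|exact IHk]. }
assert (U : forall m n, a m <= b n).
{ intros m n; apply Rle_trans with (a (m + n)%nat); [apply Ma|].
  eapply Rle_trans; [apply Hab|]; rewrite Nat.add_comm; apply Mb. }
destruct (completeness (fun x => exists n, x = a n)) as [p [P1 P2]].
- exists (b 0%nat); intros x [n ->]; apply U.
- exists (a 0%nat); now exists 0%nat.
- exists p; intros n; split; [apply P1; now exists n|].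
  apply P2; intros x [m ->]; apply U.
Qed.

(** A rectangle as [((a, b), (c, d))], packed so that the bisection becomes the iteration of one
    function. *)
Definition quad : Type := (R * R * (R * R))%type.

(** After [n] bisections the circulation is still at least [I0 / 4 ^ n], while differentiability at
    the common point of the rectangles bounds it by [2 * eta * (D / 2 ^ n) ^ 2]. The powers of 4
    cancel, and [eta] is arbitrary. *)
Lemma goursat (H : C -> C) (a b c d : R) :
  a <= b -> c <= d -> C_derivable_on H (rectangle a b c d) ->
  circulation H a b c d = 0.
Proof.
intros Hab Hcd Hd.
destruct (Req_dec (circulation H a b c d) 0) as [E|E]; [exact E|exfalso].
apply Rabs_pos_lt in E; set (I0 := Rabs (circulation H a b c d)) in *.
pose (circ := fun q : quad => circulation H (fst (fst q)) (snd (fst q)) (fst (snd q)) (snd (snd q))).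
pose (good := fun q : quad => fst (fst q) <= snd (fst q) /\ fst (snd q) <= snd (snd q) /\
  C_derivable_on H (rectangle (fst (fst q)) (snd (fst q)) (fst (snd q)) (snd (snd q)))).
pose (step := fun q r : quad =>
    fst (fst q) <= fst (fst r) /\ snd (fst r) <= snd (fst q) /\
    fst (snd q) <= fst (snd r) /\ snd (snd r) <= snd (snd q) /\
    snd (fst r) - fst (fst r) = (snd (fst q) - fst (fst q)) / 2 /\
    snd (snd r) - fst (snd r) = (snd (snd q) - fst (snd q)) / 2 /\
    Rabs (circ q) / 4 <= Rabs (circ r)).
(* [next] has to be total, so a [quad] that is not [good] is sent to itself; the relation holds
   vacuously there. *)
destruct (functional_choice (fun q r : quad => good q -> step q r)) as [next Hnext].
{ intros [[a1 b1] [c1 d1]].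
  destruct (classic (good ((a1, b1), (c1, d1)))) as [G|G].
  - destruct G as (G1 & G2 & G3).
    destruct (circulation_bisect H a1 b1 c1 d1 G1 G2 G3) as (a2 & b2 & c2 & d2 & S).
    exists ((a2, b2), (c2, d2)); intros _; exact S.
  - exists ((a1, b1), (c1, d1)); intros G'; contradiction. }
pose (Q := fun n => Nat.iter n next ((a, b), (c, d)) : quad).
assert (HQ : forall n, good (Q n) /\
  snd (fst (Q n)) - fst (fst (Q n)) = (b - a) / 2 ^ n /\
  snd (snd (Q n)) - fst (snd (Q n)) = (d - c) / 2 ^ n /\
  I0 / 4 ^ n <= Rabs (circ (Q n))).
{ induction n as [|n (G & L1 & L2 & L3)].
  - simpl; repeat split; simpl; auto; try lra.
    unfold circ, I0; simpl; lra.
  - pose proof (Hnext (Q n) G) as (S1 & S2 & S3 & S4 & S5 & S6 & S7).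
    destruct G as (G1 & G2 & G3).
    change (Q (S n)) with (next (Q n)).
    assert (P2 : 0 < 2 ^ n) by (apply pow_lt; lra).
    assert (P4 : 0 < 4 ^ n) by (apply pow_lt; lra).
    repeat split.
    + lra.
    + lra.
    + eapply rectangle_sub; [| | | |exact G3]; lra.
    + rewrite S5, L1; simpl; field; lra.
    + rewrite S6, L2; simpl; field; lra.
    + eapply Rle_trans; [|exact S7].
      replace (I0 / 4 ^ S n) with (I0 / 4 ^ n / 4) by (simpl; field; lra).
      lra. }
assert (HS : forall n, step (Q n) (Q (S n))) by (intros n; apply Hnext, HQ).
destruct (nested_intervals (fun n => fst (fst (Q n))) (fun n => snd (fst (Q n)))) as [px Hpx];
  [intros n; apply HS|intros n; apply HS|intros n; apply (HQ n)|].
destruct (nested_intervals (fun n => fst (snd (Q n))) (fun n => snd (snd (Q n)))) as [py Hpy];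
  [intros n; apply HS|intros n; apply HS|intros n; apply (HQ n)|].
destruct (Hd (px, py)) as [e He].
{ split; [exact (Hpx 0%nat)|exact (Hpy 0%nat)]. }
set (D := (b - a) + (d - c)).
assert (HD : 0 <= D) by (unfold D; lra).
(* With this [eta], [2 * eta * D ^ 2 <= I0 / 2], which will contradict [0 < I0 <= 2 * eta * D ^ 2].
   Adding 1 to [D] keeps the denominator positive even for a rectangle reduced to a point. *)
set (eta := I0 / (4 * (D + 1) ^ 2)).
assert (Heta : 0 < eta).
{ unfold eta; apply Rdiv_lt_0_compat; [exact E|]; nra. }
destruct (proj1 (is_derive_C_iff H _ e) He eta Heta) as [delta [Hdelta Hloc]].
assert (Hn : exists n, D / 2 ^ n < delta).
{ destruct (pow_lt_1_zero (/ 2) ltac:(rewrite Rabs_pos_eq; lra) (delta / (D + 1)))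
    as [n Hn]; [apply Rdiv_lt_0_compat; lra|].
  exists n; specialize (Hn n (le_n n)).
  rewrite Rabs_pos_eq in Hn by (apply pow_le; lra).
  rewrite pow_inv in Hn.
  assert (P2 : 0 < / 2 ^ n) by (apply Rinv_0_lt_compat, pow_lt; lra).
  unfold Rdiv at 1.
  apply Rle_lt_trans with ((D + 1) * / 2 ^ n); [nra|].
  apply Rlt_le_trans with ((D + 1) * (delta / (D + 1))); [nra|].
  right; field; lra. }
destruct Hn as [n Hn].
destruct (HQ n) as ((G1 & G2 & G3) & L1 & L2 & L3).
assert (P2 : 0 < 2 ^ n) by (apply pow_lt; lra).
assert (B := circulation_local H _ _ _ _ G1 G2 G3 (px, py) e eta (Rlt_le _ _ Heta)
  (conj (Hpx n) (Hpy n))).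
assert (B' : Rabs (circ (Q n)) <= 2 * eta * (D / 2 ^ n) ^ 2).
{ replace (D / 2 ^ n) with (snd (fst (Q n)) - fst (fst (Q n)) + (snd (snd (Q n)) - fst (snd (Q n)))).
  2:{ rewrite L1, L2; unfold D; field; lra. }
  apply B; intros z [Hz1 Hz2]; apply Hloc.
  eapply Rle_lt_trans; [apply Cmod_le_Rabs|].
  eapply Rle_lt_trans; [|exact Hn].
  replace (D / 2 ^ n) with (snd (fst (Q n)) - fst (fst (Q n)) + (snd (snd (Q n)) - fst (snd (Q n)))).
  2:{ rewrite L1, L2; unfold D; field; lra. }
  specialize (Hpx n); specialize (Hpy n).
  destruct z as [x y]; simpl in *.
  apply Rplus_le_compat; apply Rabs_le; lra. }
assert (C1 : I0 / 4 ^ n <= 2 * eta * (D / 2 ^ n) ^ 2) by lra.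
assert (E4 : 4 ^ n = 2 ^ n * 2 ^ n) by (rewrite <- Rpow_mult_distr; f_equal; lra).
assert (P4 : 0 < 4 ^ n) by (apply pow_lt; lra).
assert (C2 : I0 <= 2 * eta * D ^ 2).
{ replace (2 * eta * (D / 2 ^ n) ^ 2) with (2 * eta * D ^ 2 / 4 ^ n) in C1
    by (rewrite E4; field; lra).
  apply (Rmult_le_compat_r (4 ^ n)) in C1; [|lra].
  replace (I0 / 4 ^ n * 4 ^ n) with I0 in C1 by (field; lra).
  replace (2 * eta * D ^ 2 / 4 ^ n * 4 ^ n) with (2 * eta * D ^ 2) in C1 by (field; lra).
  exact C1. }
assert (C3 : eta * (4 * (D + 1) ^ 2) = I0) by (unfold eta; field; nra).
nra.
Qed.

(** * Rules for complex derivatives *)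

(* The two canonical structures on [C] as codomain have different (equivalent)
   uniform structures, but the same norm. *)
Lemma is_derive_C_AbsRing (h : C -> C) (z d : C) :
  @is_derive C_AbsRing (AbsRing_NormedModule C_AbsRing) h z d <->
  @is_derive C_AbsRing C_NormedModule h z d.
Proof.
split.
- intros [_ H]; split; [apply is_linear_scal_l|exact H].
- intros [_ H]; split; [apply is_linear_scal_l|exact H].
Qed.

Lemma is_derive_C_comp (f g : C -> C) (z df dg : C) :
  @is_derive C_AbsRing C_NormedModule f (g z) df ->
  @is_derive C_AbsRing C_NormedModule g z dg ->
  @is_derive C_AbsRing C_NormedModule (fun x => f (g x)) z (dg * df)%C.
Proof.
intros Hf Hg.
apply (is_derive_comp (K := C_AbsRing) (V := C_NormedModule) f g z df dg Hf).
now apply is_derive_C_AbsRing.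
Qed.

Lemma is_derive_C_mult (f g : C -> C) (z df dg : C) :
  @is_derive C_AbsRing C_NormedModule f z df ->
  @is_derive C_AbsRing C_NormedModule g z dg ->
  @is_derive C_AbsRing C_NormedModule (fun x => f x * g x)%C z (df * g z + f z * dg)%C.
Proof.
intros Hf Hg; apply is_derive_C_AbsRing.
apply (is_derive_mult (K := C_AbsRing) f g z df dg).
- now apply is_derive_C_AbsRing.
- now apply is_derive_C_AbsRing.
- intros n m; apply Cmult_comm.
Qed.

Lemma is_derive_C_affine (a b z : C) :
  @is_derive C_AbsRing C_NormedModule (fun x => a + b * x)%C z b.
Proof.
apply is_derive_C_iff; intros eps Heps; exists 1; split; [lra|]; intros w _.
replace (a + b * w - (a + b * z) - (w - z) * b)%C with (RtoC 0) by ring.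
rewrite Cmod_0; pose proof (Cmod_ge_0 (w - z)); nra.
Qed.

(** The error of the linear approximation is exactly [(w - z)^2 / (z^2 w)]. The first bound in the
    minimum gives [|w| > m / 2], the second then absorbs one factor [|w - z|] into
    [eps * m^2 * |w|]. *)
Lemma is_derive_Cinv (z : C) : z <> 0%C ->
  @is_derive C_AbsRing C_NormedModule Cinv z (- / (z * z))%C.
Proof.
intros Hz; apply is_derive_C_iff; intros eps Heps.
pose proof (proj1 (Cmod_gt_0 z) Hz) as Hz'.
set (m := Cmod z) in *.
assert (Hm3 : 0 < m * m * m) by (repeat apply Rmult_lt_0_compat; exact Hz').
exists (Rmin (m / 2) (eps * (m * m * m) / 2)); split.
{ pose proof (Rmult_lt_0_compat _ _ Heps Hm3); apply Rmin_glb_lt; lra. }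
intros w Hw.
pose proof (Rlt_le_trans _ _ _ Hw (Rmin_l _ _)) as H1.
pose proof (Rlt_le_trans _ _ _ Hw (Rmin_r _ _)) as H2.
assert (Hw' : m / 2 < Cmod w).
{ pose proof (Cmod_triangle w (- (w - z))) as T.
  rewrite Cmod_opp in T; replace (w + - (w - z))%C with z in T by ring.
  fold m in T; lra. }
assert (Hw0 : w <> 0%C) by (apply Cmod_gt_0; lra).
replace (/ w - / z - (w - z) * - / (z * z))%C with ((w - z) * (w - z) / (z * z * w))%C
  by (field; auto).
rewrite Cmod_div by (repeat apply Cmult_neq_0; auto).
rewrite !Cmod_mult; fold m.
assert (H3 : 0 < m * m * Cmod w) by nra.
apply (Rmult_le_reg_r (m * m * Cmod w)); [exact H3|].
unfold Rdiv; rewrite Rmult_assoc, Rinv_l, Rmult_1_r by lra.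
pose proof (Cmod_ge_0 (w - z)) as H4.
assert (H5 : m * m * (m / 2) <= m * m * Cmod w) by nra.
assert (H6 : Cmod (w - z) <= eps * (m * m * Cmod w)).
{ apply Rlt_le, (Rlt_le_trans _ _ _ H2).
  replace (eps * (m * m * m) / 2) with (eps * (m * m * (m / 2))) by field.
  now apply Rmult_le_compat_l; [lra|]. }
nra.
Qed.

(** * Cauchy's estimate *)

Definition Cexp (z : C) : C := (exp (Re z) * cos (Im z), exp (Re z) * sin (Im z)).

Lemma Cexp_plus (z w : C) : Cexp (z + w) = (Cexp z * Cexp w)%C.
Proof.
destruct z as [a b], w as [c d]; unfold Cexp, Cmult; simpl.
rewrite exp_plus, cos_plus, sin_plus; f_equal; ring.
Qed.

Lemma Cmod_Cexp (z : C) : Cmod (Cexp z) = exp (Re z).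
Proof.
unfold Cmod, Cexp; simpl.
set (e := exp (Re z)); set (c := cos (Im z)); set (s := sin (Im z)).
pose proof (sin2_cos2 (Im z)) as H; unfold Rsqr in H; fold c s in H.
pose proof (exp_pos (Re z)) as He; fold e in He.
replace (e * c * (e * c * 1) + e * s * (e * s * 1)) with (e * e * (s * s + c * c)) by ring.
rewrite H, Rmult_1_r; apply sqrt_square; lra.
Qed.

Lemma Cexp_0 : Cexp 0 = 1%C.
Proof. unfold Cexp; simpl; rewrite exp_0, cos_0, sin_0; unfold RtoC; f_equal; ring. Qed.

Lemma Cexp_opp (z : C) : (Cexp z * Cexp (- z) = 1)%C.
Proof.
rewrite <- Cexp_plus, <- Cexp_0; f_equal; ring.
Qed.

(** Clearing the denominator of the difference quotient admits [u = 0], which is needed for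
    increments of [Re] and [Im] that may vanish separately. *)
Lemma derivable_pt_lim_bound (f : R -> R) (x l eps : R) :
  derivable_pt_lim f x l -> 0 < eps -> exists delta : R, 0 < delta /\
    forall u : R, Rabs u < delta -> Rabs (f (x + u) - f x - u * l) <= eps * Rabs u.
Proof.
intros H Heps; destruct (H eps Heps) as [delta Hd].
exists delta; split; [apply cond_pos|]; intros u Hu.
destruct (Req_dec u 0) as [->|Hu0].
{ rewrite Rplus_0_r, Rabs_R0.
  replace (f x - f x - 0 * l) with 0 by ring; rewrite Rabs_R0; lra. }
specialize (Hd u Hu0 Hu).
replace (f (x + u) - f x - u * l) with (((f (x + u) - f x) / u - l) * u) by (field; auto).
rewrite Rabs_mult; apply Rmult_le_compat_r; [apply Rabs_pos|lra].
Qed.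

(** For [k = u + i v] the real part of the error is [(e^u - 1 - u) + e^u (cos v - 1)] and the
    imaginary part [e^u (sin v - v) + (e^u - 1) v]; each is kept below [eps / 2 * |k|]. *)
Lemma Cexp_near_0 (eps : R) : 0 < eps -> exists delta : R, 0 < delta /\
  forall k : C, Cmod k < delta -> Cmod (Cexp k - 1 - k) <= eps * Cmod k.
Proof.
intros Heps.
destruct (derivable_pt_lim_bound exp 0 1 (Rmin 1 (eps / 6))) as [d1 [P1 D1]].
{ rewrite <- exp_0; apply derivable_pt_lim_exp. }
{ apply Rmin_glb_lt; lra. }
destruct (derivable_pt_lim_bound sin 0 1 (eps / 6)) as [d2 [P2 D2]].
{ rewrite <- cos_0; apply derivable_pt_lim_sin. }
{ lra. }
destruct (derivable_pt_lim_bound cos 0 0 (eps / 6)) as [d3 [P3 D3]].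
{ replace 0 with (- sin 0) at 2 by (rewrite sin_0; ring); apply derivable_pt_lim_cos. }
{ lra. }
(* The bound [/ 2] gives [e^u <= 2], through [|e^u - 1| <= 2 |k|]; the bound [eps / 12] controls the
   product [(e^u - 1) v]. *)
exists (Rmin (Rmin d1 (Rmin d2 d3)) (Rmin (/ 2) (eps / 12))); split.
{ repeat apply Rmin_glb_lt; lra. }
intros k Hk.
pose proof (re_le_Cmod k) as Hu; pose proof (Im_le_Cmod k) as Hv.
set (m := Cmod k) in *; set (u := Re k) in *; set (v := Im k) in *.
assert (K1 : m < d1 /\ m < d2 /\ m < d3 /\ m < / 2 /\ m < eps / 12).
{ pose proof (Rmin_l (Rmin d1 (Rmin d2 d3)) (Rmin (/ 2) (eps / 12))).
  pose proof (Rmin_r (Rmin d1 (Rmin d2 d3)) (Rmin (/ 2) (eps / 12))).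
  pose proof (Rmin_l d1 (Rmin d2 d3)); pose proof (Rmin_r d1 (Rmin d2 d3)).
  pose proof (Rmin_l d2 d3); pose proof (Rmin_r d2 d3).
  pose proof (Rmin_l (/ 2) (eps / 12)); pose proof (Rmin_r (/ 2) (eps / 12)).
  repeat split; lra. }
specialize (D1 u ltac:(lra)); specialize (D2 v ltac:(lra)); specialize (D3 v ltac:(lra)).
rewrite Rplus_0_l, exp_0 in D1; rewrite Rplus_0_l, sin_0 in D2; rewrite Rplus_0_l, cos_0 in D3.
pose proof (Rabs_pos u); pose proof (Rabs_pos v).
assert (D1a : Rabs (exp u - 1 - u) <= eps / 6 * m).
{ replace (exp u - 1 - u) with (exp u - 1 - u * 1) by ring.
  eapply Rle_trans; [exact D1|].
  pose proof (Rmin_r 1 (eps / 6)); pose proof (Rmin_glb_lt 1 (eps / 6) 0); nra. }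
assert (D1b : Rabs (exp u - 1) <= 2 * m).
{ replace (exp u - 1) with ((exp u - 1 - u * 1) + u) by ring.
  eapply Rle_trans; [apply Rabs_triang|].
  pose proof (Rmin_l 1 (eps / 6)); nra. }
assert (E2 : 0 < exp u <= 2).
{ split; [apply exp_pos|].
  pose proof (Rle_abs (exp u - 1)); lra. }
replace (cos v - 1 - v * 0) with (cos v - 1) in D3 by ring.
replace (sin v - 0 - v * 1) with (sin v - v) in D2 by ring.
assert (A : Rabs (Re (Cexp k - 1 - k)) <= eps / 2 * m).
{ replace (Re (Cexp k - 1 - k)) with ((exp u - 1 - u) + exp u * (cos v - 1))
    by (unfold u, v; destruct k; simpl; ring).
  eapply Rle_trans; [apply Rabs_triang|].
  rewrite Rabs_mult, (Rabs_pos_eq (exp u)) by lra.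
  assert (exp u * Rabs (cos v - 1) <= 2 * (eps / 6 * m)).
  { apply Rmult_le_compat; try lra; [apply Rabs_pos|]; nra. }
  lra. }
assert (B : Rabs (Im (Cexp k - 1 - k)) <= eps / 2 * m).
{ replace (Im (Cexp k - 1 - k)) with (exp u * (sin v - v) + (exp u - 1) * v)
    by (unfold u, v; destruct k; simpl; ring).
  eapply Rle_trans; [apply Rabs_triang|].
  rewrite !Rabs_mult, (Rabs_pos_eq (exp u)) by lra.
  assert (exp u * Rabs (sin v - v) <= 2 * (eps / 6 * m)).
  { apply Rmult_le_compat; try lra; [apply Rabs_pos|]; nra. }
  assert (Rabs (exp u - 1) * Rabs v <= 2 * (eps / 12) * m).
  { apply Rmult_le_compat; try lra; apply Rabs_pos. }
  lra. }
eapply Rle_trans; [apply Cmod_le_Rabs|]; lra.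
Qed.

Lemma is_derive_Cexp (z : C) :
  @is_derive C_AbsRing C_NormedModule Cexp z (Cexp z).
Proof.
apply is_derive_C_iff; intros eps Heps.
pose proof (exp_pos (Re z)) as He.
destruct (Cexp_near_0 (eps / exp (Re z))) as [delta [Hd H]].
{ now apply Rdiv_lt_0_compat. }
exists delta; split; [exact Hd|]; intros w Hw.
specialize (H (w - z)%C Hw).
replace (Cexp w) with (Cexp z * Cexp (w - z))%C
  by (rewrite <- Cexp_plus; f_equal; ring).
replace (Cexp z * Cexp (w - z) - Cexp z - (w - z) * Cexp z)%C
  with (Cexp z * (Cexp (w - z) - 1 - (w - z)))%C by ring.
rewrite Cmod_mult, Cmod_Cexp.
apply (Rmult_le_compat_l (exp (Re z))) in H; [|lra].
eapply Rle_trans; [exact H|]; right; field; lra.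
Qed.

(* In the coordinate [z0 + exp zeta] the integrals of
   [h (z0 + exp zeta) exp (- zeta)] over the vertical segments of length
   [2 PI] agree; as [Re zeta] tends to [-oo] the integrand tends to [d]. *)
Lemma cauchy_estimate_Im (h : C -> C) (z0 d : C) (r M : R) :
  0 < r -> h z0 = 0%C ->
  C_derivable_on h (fun z => Cmod (z - z0) <= r) ->
  (forall z : C, Cmod (z - z0) <= r -> Cmod (h z) <= M) ->
  @is_derive C_AbsRing C_NormedModule h z0 d ->
  Rabs (Im d) <= M / r.
Proof.
intros Hr Hz0 Hh HM Hd.
apply le_epsilon; intros eps Heps.
destruct (proj1 (is_derive_C_iff h z0 d) Hd eps Heps) as [delta [Hdelta Hloc]].
set (G := fun zeta : C => (h (z0 + Cexp zeta) * Cexp (- zeta))%C).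
set (b := ln r).
(* [exp a < delta] puts the left side of the rectangle where the derivative estimate at [z0]
   applies; the minimum keeps [a <= b] when [delta] is large. *)
set (a := Rmin b (ln (delta / 2))).
assert (Hab : a <= b) by apply Rmin_l.
assert (Eb : exp b = r) by (apply exp_ln, Hr).
assert (Ea : exp a < delta).
{ apply Rle_lt_trans with (exp (ln (delta / 2))).
  - destruct (Rmin_r b (ln (delta / 2))) as [L|L]; fold a in L.
    + left; now apply exp_increasing.
    + rewrite L; lra.
  - rewrite exp_ln; lra. }
assert (HG : C_derivable_on G (rectangle a b 0 (2 * PI))).
{ intros zeta [[Z1 Z2] _].
  destruct (Hh (z0 + 1 * Cexp zeta)%C) as [e He].
  { replace (z0 + 1 * Cexp zeta - z0)%C with (Cexp zeta) by ring.
    rewrite Cmod_Cexp, <- Eb.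
    destruct Z2 as [Z2|Z2]; [left; now apply exp_increasing|rewrite Z2; lra]. }
  eexists.
  apply is_derive_C_mult.
  - apply (is_derive_C_comp h (fun x => z0 + Cexp x)%C).
    + replace (z0 + 1 * Cexp zeta)%C with (z0 + Cexp zeta)%C in He by ring; exact He.
    + apply (is_derive_ext (fun x => z0 + 1 * Cexp x)%C); [intros t; apply f_equal, Cmult_1_l|].
      apply (is_derive_C_comp (fun x => z0 + 1 * x)%C Cexp).
      * apply is_derive_C_affine.
      * apply is_derive_Cexp.
  - apply (is_derive_C_comp Cexp Copp).
    + apply is_derive_Cexp.
    + apply (is_derive_ext (fun x => 0 + - (1) * x)%C).
      * intros t; change (0 + - (1) * t = - t)%C; ring.
      * apply is_derive_C_affine. }
assert (Hpi : 0 < 2 * PI) by (pose proof PI_RGT_0; lra).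
pose proof (goursat G a b 0 (2 * PI) Hab (Rlt_le _ _ Hpi) HG) as Hg.
assert (Hper : forall x, G (x, 2 * PI) = G (x, 0)).
{ intros x; unfold G, Cexp, Copp; simpl.
  now rewrite !cos_neg, !sin_neg, cos_2PI, sin_2PI, cos_0, sin_0. }
unfold circulation in Hg.
assert (E0 : RInt (fun x => Re (G (x, 0)) - Re (G (x, 2 * PI))) a b = 0).
{ rewrite (RInt_ext _ (fun _ => 0)).
  - rewrite RInt_const; unfold scal; simpl; unfold mult; simpl; ring.
  - intros x _; rewrite Hper; apply Rminus_diag. }
rewrite E0, Rplus_0_l in Hg.
(* The horizontal sides cancel by periodicity, so the integral over the vertical sides vanishes and
   this one equals [- 2 * PI * Im d]. Its integrand is at most [M / r + eps]: on the left side [G]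
   is within [eps] of [d], on the right side [|G| <= M / r]. *)
assert (I : is_RInt (fun y => minus (Im (G (a, y)) - Im (G (b, y))) (Im d)) 0 (2 * PI)
  (minus 0 (scal (2 * PI - 0) (Im d)))).
{ apply (is_RInt_minus (V := R_NormedModule)).
  - pose proof (RInt_correct (V := R_CompleteNormedModule) _ _ _
      (ex_RInt_verticals G a b 0 (2 * PI) HG a b 0 (2 * PI)
         ltac:(lra) ltac:(lra) ltac:(lra) ltac:(lra) ltac:(lra))) as J.
    rewrite Hg in J; exact J.
  - apply (is_RInt_const (V := R_NormedModule)). }
apply (norm_RInt_le_const (V := R_NormedModule) _ _ _ _ (M / r + eps) (Rlt_le _ _ Hpi)) in I.
- change norm with Rabs in I; simpl in I.
  unfold minus, plus, opp, scal in I; simpl in I; unfold mult in I; simpl in I.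
  replace (0 + - ((2 * PI - 0) * Im d)) with (- (2 * PI * Im d)) in I by ring.
  rewrite Rabs_Ropp, Rabs_mult, Rabs_pos_eq in I by lra.
  rewrite Rminus_0_r in I.
  now apply (Rmult_le_reg_l (2 * PI)).
- intros y Hy.
  change (Rabs (Im (G (a, y)) - Im (G (b, y)) - Im d) <= M / r + eps).
  assert (B1 : Cmod (G (a, y) - d) <= eps).
  { unfold G; set (k := Cexp (a, y)).
    assert (Hk : Cmod k = exp a) by (unfold k; now rewrite Cmod_Cexp).
    specialize (Hloc (z0 + k)%C).
    replace (z0 + k - z0)%C with k in Hloc by ring.
    rewrite Hk, Hz0 in Hloc; specialize (Hloc Ea).
    replace (h (z0 + k) - 0 - k * d)%C with (h (z0 + k) - k * d)%C in Hloc by ring.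
    pose proof (Cexp_opp (a, y)) as Hinv; fold k in Hinv.
    set (k' := Cexp (- (a, y))) in *.
    replace (h (z0 + k) * k' - d)%C with ((h (z0 + k) - k * d) * k')%C.
    2:{ replace ((h (z0 + k) - k * d) * k')%C with (h (z0 + k) * k' - (k * k') * d)%C by ring.
        rewrite Hinv; ring. }
    rewrite Cmod_mult.
    assert (Hk' : exp a * Cmod k' = 1).
    { rewrite <- Hk, <- Cmod_mult, Hinv; apply Cmod_1. }
    pose proof (Cmod_ge_0 k').
    apply Rle_trans with (eps * exp a * Cmod k').
    - now apply Rmult_le_compat_r.
    - rewrite Rmult_assoc, Hk'; lra. }
  assert (B2 : Cmod (G (b, y)) <= M / r).
  { unfold G; rewrite Cmod_mult, !Cmod_Cexp; simpl.
    rewrite exp_Ropp, Eb; apply Rmult_le_compat_r.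
    - left; now apply Rinv_0_lt_compat.
    - apply HM; replace (z0 + Cexp (b, y) - z0)%C with (Cexp (b, y)) by ring.
      rewrite Cmod_Cexp; simpl; rewrite Eb; lra. }
  pose proof (Rle_trans _ _ _ (Im_dist (G (a, y)) d) B1) as B3.
  pose proof (Rle_trans _ _ _ (Im_le_Cmod (G (b, y))) B2) as B4.
  replace (Im (G (a, y)) - Im (G (b, y)) - Im d)
    with ((Im (G (a, y)) - Im d) - Im (G (b, y))) by ring.
  eapply Rle_trans; [apply Rabs_triang|]; rewrite Rabs_Ropp; lra.
Qed.

(** The factor 2 comes from subtracting [h z0], since the estimate of the imaginary part supposes a
    zero at the centre. Multiplying by [Ci * Cconj d] instead of a unimodular constant avoids a
    division by [|d|]: the result is [|d|^2 <= |d| * 2 M / r], and [d = 0] is treated apart. *)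
Lemma cauchy_estimate (h : C -> C) (z0 d : C) (r M : R) :
  0 < r ->
  C_derivable_on h (fun z => Cmod (z - z0) <= r) ->
  (forall z : C, Cmod (z - z0) <= r -> Cmod (h z) <= M) ->
  @is_derive C_AbsRing C_NormedModule h z0 d ->
  Cmod d <= 2 * M / r.
Proof.
intros Hr Hh HM Hd.
assert (HM0 : Cmod (h z0) <= M).
{ apply HM; replace (z0 - z0)%C with (RtoC 0) by ring; rewrite Cmod_0; lra. }
(* [d * c = Ci * |d|^2] is purely imaginary. *)
set (c := (Ci * Cconj d)%C).
assert (Hc : Cmod c = Cmod d) by (unfold c; rewrite Cmod_mult, Cmod_Ci, Cmod_conj; ring).
pose proof (Cmod_ge_0 d) as Hd0.
assert (X : forall z e, @is_derive C_AbsRing C_NormedModule h z e ->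
  @is_derive C_AbsRing C_NormedModule (fun x => - (c * h z0) + c * h x)%C z (e * c)%C).
{ intros z e He.
  apply (is_derive_C_comp (fun x => - (c * h z0) + c * x)%C h); [|exact He].
  apply is_derive_C_affine. }
pose proof (cauchy_estimate_Im (fun x => - (c * h z0) + c * h x)%C z0 (d * c)%C r
  (Cmod d * (2 * M)) Hr) as E.
assert (E' : Rabs (Im (d * c)) <= Cmod d * (2 * M) / r).
{ apply E.
  - ring.
  - intros z Hz; destruct (Hh z Hz) as [e He]; exists (e * c)%C; now apply X.
  - intros z Hz.
    replace (- (c * h z0) + c * h z)%C with (c * (h z - h z0))%C by ring.
    rewrite Cmod_mult, Hc; apply Rmult_le_compat_l; [exact Hd0|].
    eapply Rle_trans; [apply Cmod_triangle|]; rewrite Cmod_opp.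
    specialize (HM z Hz); lra.
  - now apply X. }
replace (Im (d * c)) with (Cmod d ^ 2) in E'
  by (rewrite Cmod2_alt; unfold c; destruct d; simpl; ring).
rewrite Rabs_pos_eq in E' by nra.
destruct Hd0 as [Hd0|Hd0].
- apply (Rmult_le_reg_l (Cmod d)); [exact Hd0|].
  unfold Rdiv in *; nra.
- rewrite <- Hd0; pose proof (Cmod_ge_0 (h z0)).
  apply Rdiv_le_0_compat; lra.
Qed.

(** * Pseudo-hyperbolic geometry *)

(** The right side is positive in the disc, which is what makes [pseudo_hyp] less than 1. *)
Lemma one_minus_conj_mult_identity (z w : C) :
  Cmod (1 - Cconj z * w) ^ 2 - Cmod (z - w) ^ 2 = (1 - Cmod z ^ 2) * (1 - Cmod w ^ 2).
Proof. rewrite !Cmod2_alt; destruct z, w; simpl; ring. Qed.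

Lemma one_minus_conj_mult_ge (z w : C) : in_disc w ->
  1 - Cmod z <= Cmod (1 - Cconj z * w).
Proof.
unfold in_disc; intros Hw.
pose proof (Cmod_triangle (1 - Cconj z * w) (Cconj z * w)) as T.
replace (1 - Cconj z * w + Cconj z * w)%C with (RtoC 1) in T by ring.
rewrite Cmod_1, Cmod_mult, Cmod_conj in T.
pose proof (Cmod_ge_0 z); nra.
Qed.

Lemma one_minus_conj_mult_sym (z w : C) :
  Cmod (1 - Cconj w * z) = Cmod (1 - Cconj z * w).
Proof.
rewrite <- (Cmod_conj (1 - Cconj z * w)); f_equal.
destruct z, w; unfold Cconj, Cminus, Cplus, Copp, Cmult, RtoC; simpl; f_equal; ring.
Qed.

Lemma pseudo_hyp_eq (z w : C) : in_disc z -> in_disc w ->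
  pseudo_hyp z w = Cmod (z - w) / Cmod (1 - Cconj z * w).
Proof.
intros Hz Hw; unfold pseudo_hyp; apply Cmod_div.
apply Cmod_gt_0; pose proof (one_minus_conj_mult_ge z w Hw).
unfold in_disc in Hz; lra.
Qed.

Lemma pseudo_hyp_sym (z w : C) : in_disc z -> in_disc w ->
  pseudo_hyp w z = pseudo_hyp z w.
Proof.
intros Hz Hw; rewrite !pseudo_hyp_eq, one_minus_conj_mult_sym by assumption.
f_equal; replace (w - z)%C with (- (z - w))%C by ring; apply Cmod_opp.
Qed.

Lemma pseudo_hyp_range (z w : C) : in_disc z -> in_disc w ->
  0 <= pseudo_hyp z w < 1.
Proof.
intros Hz Hw; rewrite pseudo_hyp_eq by assumption.
pose proof (one_minus_conj_mult_ge z w Hw) as H1.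
pose proof (one_minus_conj_mult_identity z w) as H2.
pose proof (Cmod_ge_0 (z - w)); pose proof (Cmod_ge_0 z); pose proof (Cmod_ge_0 w).
unfold in_disc in *.
assert (0 < (1 - Cmod z ^ 2) * (1 - Cmod w ^ 2)) by (apply Rmult_lt_0_compat; nra).
split.
- apply Rdiv_le_0_compat; lra.
- apply (Rmult_lt_reg_r (Cmod (1 - Cconj z * w))); [lra|].
  unfold Rdiv; rewrite Rmult_assoc, Rinv_l by lra; nra.
Qed.

(** The denominator [|1 - conj z * w|] is at least [1 - |z|]. *)
Lemma pseudo_hyp_le (z w : C) (delta : R) : in_disc z -> in_disc w ->
  0 <= delta -> Cmod (z - w) <= delta * (1 - Cmod z) -> pseudo_hyp z w <= delta.
Proof.
intros Hz Hw Hdelta H; rewrite pseudo_hyp_eq by assumption.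
pose proof (one_minus_conj_mult_ge z w Hw) as H1; unfold in_disc in *.
apply (Rmult_le_reg_r (Cmod (1 - Cconj z * w))); [lra|].
unfold Rdiv; rewrite Rmult_assoc, Rinv_l by lra; nra.
Qed.

(** Since [1 - conj z * w = (1 - |z|^2) + conj z * (z - w)], the denominator is at most
    [2 (1 - |z|) + |w - z|]. Absorbing [|w - z|] leaves the factor [2 p / (1 - p)], and [p <= / 5]
    makes it at most [5 / 2 * p]. The right side is then at most [(1 - |z|) / 2], which keeps the
    segment from [z] to [w] well inside the disc. *)
Lemma Cmod_minus_le_pseudo_hyp (z w : C) : in_disc z -> in_disc w ->
  pseudo_hyp z w <= / 5 -> Cmod (w - z) <= 5 / 2 * pseudo_hyp z w * (1 - Cmod z).
Proof.
intros Hz Hw Hp; pose proof (pseudo_hyp_range z w Hz Hw) as Hr.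
set (p := pseudo_hyp z w) in *.
assert (E : Cmod (w - z) = p * Cmod (1 - Cconj z * w)).
{ unfold p; rewrite pseudo_hyp_eq by assumption.
  replace (w - z)%C with (- (z - w))%C by ring; rewrite Cmod_opp; field.
  pose proof (one_minus_conj_mult_ge z w Hw); unfold in_disc in *; lra. }
assert (T : Cmod (1 - Cconj z * w) <= 2 * (1 - Cmod z) + Cmod (w - z)).
{ replace (1 - Cconj z * w)%C with (RtoC (1 - Cmod z ^ 2) + Cconj z * (z - w))%C.
  2:{ rewrite RtoC_minus, Cmod2_conj; ring. }
  eapply Rle_trans; [apply Cmod_triangle|].
  rewrite Cmod_R, Cmod_mult, Cmod_conj.
  replace (z - w)%C with (- (w - z))%C by ring; rewrite Cmod_opp.
  pose proof (Cmod_ge_0 z); pose proof (Cmod_ge_0 (w - z)); unfold in_disc in *.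
  rewrite Rabs_pos_eq by nra; nra. }
pose proof (Cmod_ge_0 (w - z)) as Hd.
assert (T1 : Cmod (w - z) <= p * (2 * (1 - Cmod z) + Cmod (w - z)))
  by (rewrite E at 1; apply Rmult_le_compat_l; lra).
assert (T2 : p * Cmod (w - z) <= / 5 * Cmod (w - z)) by (apply Rmult_le_compat_r; lra).
lra.
Qed.

(** With [p] the pseudo-hyperbolic distance, [exp (2 * hyp_dist) - 1 = 2 p / (1 - p) >= p]; the
    converse is continuity at [p = 0]. *)
Lemma is_lim_seq_hyp_dist (z w : nat -> C) :
  (forall n, in_disc (z n)) -> (forall n, in_disc (w n)) ->
  (is_lim_seq (fun n => hyp_dist (z n) (w n)) 0 <->
   is_lim_seq (fun n => pseudo_hyp (z n) (w n)) 0).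
Proof.
intros Hz Hw; split; intros H.
- apply (is_lim_seq_le_le (fun _ => 0) _ (fun n => exp (2 * hyp_dist (z n) (w n)) - 1)).
  + intros n; pose proof (pseudo_hyp_range _ _ (Hz n) (Hw n)) as Hp.
    split; [lra|]; unfold hyp_dist; set (p := pseudo_hyp (z n) (w n)) in *.
    replace (2 * (/ 2 * ln ((1 + p) / (1 - p)))) with (ln ((1 + p) / (1 - p))) by field.
    rewrite exp_ln by (apply Rdiv_lt_0_compat; lra).
    replace ((1 + p) / (1 - p) - 1) with (2 * p / (1 - p)) by (field; lra).
    apply (Rmult_le_reg_r (1 - p)); [lra|].
    unfold Rdiv; rewrite Rmult_assoc, Rinv_l by lra; nra.
  + apply is_lim_seq_const.
  + replace (Finite 0) with (Finite ((fun x => exp (2 * x) - 1) 0))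
      by (simpl; rewrite Rmult_0_r, exp_0; f_equal; ring).
    apply (is_lim_seq_continuous (fun x => exp (2 * x) - 1) _ 0); [|exact H].
    apply derivable_continuous_pt, ex_derive_Reals_0; auto_derive; exact I.
- replace (Finite 0) with (Finite ((fun p => / 2 * ln ((1 + p) / (1 - p))) 0)).
  2:{ simpl; replace ((1 + 0) / (1 - 0)) with 1 by field; rewrite ln_1; f_equal; ring. }
  apply (is_lim_seq_continuous (fun p => / 2 * ln ((1 + p) / (1 - p))) _ 0); [|exact H].
  apply derivable_continuous_pt, ex_derive_Reals_0; auto_derive.
  repeat split; [lra|apply Rdiv_lt_0_compat; lra].
Qed.

(** * Normality implies the limit condition *)

(** Here the neighbourhoods are those of the product structure on [C], whose balls are squares;
    hence the factor [sqrt 2]. *)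
Lemma C_seq_lim_iff (u : nat -> C) (l : C) :
  C_seq_lim u l <->
  (forall eps : R, 0 < eps -> exists N, forall n, (N <= n)%nat -> Cmod (u n - l) < eps).
Proof.
unfold C_seq_lim; split; intros H.
- intros eps Heps; pose proof (proj1 (filterlim_locally _ _) H) as H'; clear H.
  assert (Hs : 0 < sqrt 2) by (apply sqrt_lt_R0; lra).
  assert (He : 0 < eps / sqrt 2) by now apply Rdiv_lt_0_compat.
  destruct (H' (mkposreal _ He)) as [N HN]; exists N; intros n Hn.
  replace eps with (sqrt 2 * (eps / sqrt 2)) by (field; lra).
  exact (C_NormedModule_mixin_compat2 l (u n) (mkposreal _ He) (HN n Hn)).
- apply filterlim_locally; intros eps.
  destruct (H eps (cond_pos eps)) as [N HN]; exists N; intros n Hn.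
  apply C_NormedModule_mixin_compat1; exact (HN n Hn).
Qed.

Lemma is_lim_seq_Reals_iff (u : nat -> R) (l : R) :
  is_lim_seq u l <->
  (forall eps : R, 0 < eps -> exists N, forall n, (N <= n)%nat -> Rabs (u n - l) < eps).
Proof.
rewrite <- is_lim_seq_spec; split; intros H.
- intros eps Heps; exact (H (mkposreal eps Heps)).
- intros eps; exact (H eps (cond_pos eps)).
Qed.

Lemma C_seq_lim_Re_Im (u : nat -> C) (l : C) :
  C_seq_lim u l <->
  is_lim_seq (fun n => Re (u n)) (Re l) /\ is_lim_seq (fun n => Im (u n)) (Im l).
Proof.
rewrite C_seq_lim_iff, !is_lim_seq_Reals_iff; split.
- intros H; split; intros eps Heps; destruct (H eps Heps) as [N HN]; exists N;
    intros n Hn; (eapply Rle_lt_trans; [|exact (HN n Hn)]);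
    [apply Re_dist|apply Im_dist].
- intros [H1 H2] eps Heps.
  destruct (H1 (eps / 2) ltac:(lra)) as [N1 HN1].
  destruct (H2 (eps / 2) ltac:(lra)) as [N2 HN2].
  exists (max N1 N2); intros n Hn.
  specialize (HN1 n ltac:(lia)); specialize (HN2 n ltac:(lia)).
  eapply Rle_lt_trans; [apply Cmod_le_Rabs|].
  unfold Rminus in *; destruct (u n), l; simpl in *; lra.
Qed.

(** The hypotheses on [q] are those shared by [Re] and [Im], so that one chain rule serves both. *)
Lemma is_derive_along_line (h : C -> C) (q : C -> R) (z v d : C) (t : R) :
  (forall x y : C, q (x - y)%C = q x - q y) ->
  (forall (s : R) (x : C), q (s * x)%C = s * q x) ->
  (forall x : C, Rabs (q x) <= Cmod x) ->
  @is_derive C_AbsRing C_NormedModule h (z + t * v)%C d ->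
  is_derive (fun s : R => q (h (z + s * v)%C)) t (q (v * d)%C).
Proof.
intros Hsub Hscal Hle Hd.
apply is_derive_Reals; intros eps Heps.
pose proof (Cmod_ge_0 v) as Hv.
(* The factor 2 yields the strict inequality, and [Cmod v + 1] allows [v = 0]. *)
destruct (proj1 (is_derive_C_iff _ _ _) Hd (eps / (2 * (Cmod v + 1)))) as [delta [H0 H1]].
{ apply Rdiv_lt_0_compat; lra. }
assert (Hdelta : 0 < delta / (Cmod v + 1)) by (apply Rdiv_lt_0_compat; lra).
exists (mkposreal _ Hdelta); simpl; intros k Hk0 Hk.
pose proof (Rabs_pos_lt k Hk0) as Hk1.
set (w := (z + RtoC (t + k) * v)%C).
assert (Ew : (w - (z + t * v) = k * v)%C) by (unfold w; rewrite RtoC_plus; ring).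
specialize (H1 w); rewrite Ew, Cmod_mult, Cmod_R in H1.
assert (Hlt : Rabs k * Cmod v < delta).
{ apply Rle_lt_trans with (Rabs k * (Cmod v + 1)); [nra|].
  apply (Rmult_lt_compat_r (Cmod v + 1)) in Hk; [|lra].
  replace (delta / (Cmod v + 1) * (Cmod v + 1)) with delta in Hk by (field; lra).
  exact Hk. }
specialize (H1 Hlt).
apply (Rle_trans _ _ _ (Hle _)) in H1.
rewrite !Hsub, <- Cmult_assoc, Hscal in H1.
set (D := q (h w) - q (h (z + t * v)%C)) in *.
replace (D / k - q (v * d)%C) with ((D - k * q (v * d)%C) / k) by (field; exact Hk0).
rewrite Rabs_div by exact Hk0.
apply (Rmult_lt_reg_r (Rabs k)); [exact Hk1|].
unfold Rdiv; rewrite Rmult_assoc, Rinv_l, Rmult_1_r by lra.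
eapply Rle_lt_trans; [exact H1|].
assert (Hc : eps / (2 * (Cmod v + 1)) * (Cmod v + 1) = eps / 2) by (field; lra).
assert (0 < eps / (2 * (Cmod v + 1))) by (apply Rdiv_lt_0_compat; lra).
nra.
Qed.

Lemma lipschitz_unit_interval (F dF : R -> R) (B : R) :
  (forall t, 0 <= t <= 1 -> is_derive F t (dF t)) ->
  (forall t, 0 <= t <= 1 -> Rabs (dF t) <= B) ->
  Rabs (F 1 - F 0) <= B.
Proof.
intros Hd HB.
destruct (MVT_gen F 0 1 dF) as [c [Hc E]].
- rewrite Rmin_left, Rmax_right by lra; intros x Hx; apply Hd; lra.
- rewrite Rmin_left, Rmax_right by lra; intros x Hx.
  apply derivable_continuous_pt, ex_derive_Reals_0; eexists; now apply Hd.
- rewrite Rmin_left, Rmax_right in Hc by lra.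
  rewrite E, Rminus_0_r, Rmult_1_r; now apply HB.
Qed.

(* The functions [1/N], [a/N], [b/N], where [N = 1 + a^2 + b^2], are, up to
   affine maps, the coordinates of the stereographic projection of [a + i b]:
   a curve of spherical length at most [L] moves them by at most [4 L]. *)
Lemma stereographic_lipschitz (a b da db : R -> R) (L : R) :
  let N := fun t => 1 + (a t ^ 2 + b t ^ 2) in
  (forall t, 0 <= t <= 1 -> is_derive a t (da t)) ->
  (forall t, 0 <= t <= 1 -> is_derive b t (db t)) ->
  (forall t, 0 <= t <= 1 -> Rabs (da t) <= L * N t) ->
  (forall t, 0 <= t <= 1 -> Rabs (db t) <= L * N t) ->
  Rabs (/ N 1 - / N 0) <= 4 * L /\
  Rabs (a 1 / N 1 - a 0 / N 0) <= 4 * L /\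
  Rabs (b 1 / N 1 - b 0 / N 0) <= 4 * L.
Proof.
intros N Ha Hb Hda Hdb.
assert (HN : forall t, 1 <= N t).
{ intros t; unfold N; pose proof (pow2_ge_0 (a t)); pose proof (pow2_ge_0 (b t)); lra. }
assert (HN0 : forall t, 0 < N t) by (intros t; specialize (HN t); lra).
set (dN := fun t => 2 * (a t * da t + b t * db t)).
assert (HdN : forall t, 0 <= t <= 1 -> is_derive N t (dN t)).
{ intros t Ht; unfold N, dN.
  auto_derive.
  - repeat split; [exists (da t)|exists (db t)]; auto.
  - replace (Derive (fun x : R => a x) t) with (da t)
      by (symmetry; apply is_derive_unique, Ha, Ht).
    replace (Derive (fun x : R => b x) t) with (db t)
      by (symmetry; apply is_derive_unique, Hb, Ht).
    ring. }
assert (BL : 0 <= L).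
{ specialize (Hda 0 ltac:(lra)); pose proof (Rabs_pos (da 0)); specialize (HN0 0); nra. }
assert (Bsum : forall t, 0 <= t <= 1 ->
  Rabs (dN t) <= 2 * ((Rabs (a t) + Rabs (b t)) * (L * N t))).
{ intros t Ht; unfold dN; rewrite Rabs_mult, (Rabs_pos_eq 2) by lra.
  apply Rmult_le_compat_l; [lra|].
  eapply Rle_trans; [apply Rabs_triang|]; rewrite !Rabs_mult, Rmult_plus_distr_r.
  apply Rplus_le_compat; apply Rmult_le_compat_l; auto using Rabs_pos. }
assert (Nabs : forall t, N t = 1 + (Rabs (a t) ^ 2 + Rabs (b t) ^ 2)).
{ intros t; unfold N; rewrite !pow2_abs; reflexivity. }
(* In [(c' N - c N') / N^2] the first term contributes [L]; the second contributes [3 L], because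
   [|N'| <= 2 (|a| + |b|) L N]. The functions [1], [a] and [b] all satisfy the condition on [c]. *)
assert (Hquot : forall c dc : R -> R,
  (forall t, 0 <= t <= 1 -> is_derive c t (dc t)) ->
  (forall t, 0 <= t <= 1 -> Rabs (dc t) <= L * N t) ->
  (forall t, 2 * (Rabs (c t) * (Rabs (a t) + Rabs (b t))) <= 3 * N t) ->
  Rabs (c 1 / N 1 - c 0 / N 0) <= 4 * L).
{ intros c dc Hc Hdc Hcab.
  apply (lipschitz_unit_interval (fun t => c t / N t)
    (fun t => (dc t * N t - c t * dN t) / N t ^ 2)).
  - intros t Ht; apply is_derive_div; auto; specialize (HN0 t); lra.
  - intros t Ht; specialize (HN0 t).
    rewrite Rabs_div, (Rabs_pos_eq (N t ^ 2)) by nra.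
    apply (Rmult_le_reg_r (N t ^ 2)); [nra|].
    unfold Rdiv; rewrite Rmult_assoc, Rinv_l, Rmult_1_r by nra.
    eapply Rle_trans; [apply Rabs_triang|].
    rewrite Rabs_Ropp, !Rabs_mult, (Rabs_pos_eq (N t)) by lra.
    specialize (Bsum t Ht); specialize (Hdc t Ht); specialize (Hcab t).
    assert (S1 : Rabs (dc t) * N t <= L * N t * N t) by nra.
    assert (S2 : Rabs (c t) * Rabs (dN t) <=
      Rabs (c t) * (2 * ((Rabs (a t) + Rabs (b t)) * (L * N t))))
      by (apply Rmult_le_compat_l; [apply Rabs_pos|exact Bsum]).
    assert (S3 : 2 * (Rabs (c t) * (Rabs (a t) + Rabs (b t))) * (L * N t) <= 3 * N t * (L * N t))
      by (apply Rmult_le_compat_r; [nra|exact Hcab]).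
    nra. }
split; [|split].
- rewrite <- (Rmult_1_l (/ N 1)), <- (Rmult_1_l (/ N 0)).
  apply (Hquot (fun _ => 1) (fun _ => 0)).
  + intros t _; apply (is_derive_const (V := R_NormedModule)).
  + intros t _; rewrite Rabs_R0; specialize (HN0 t); nra.
  + intros t; rewrite Rabs_R1, Nabs.
    pose proof (pow2_ge_0 (Rabs (a t) - 1)); pose proof (pow2_ge_0 (Rabs (b t) - 1)).
    pose proof (pow2_ge_0 (Rabs (a t))); pose proof (pow2_ge_0 (Rabs (b t))); nra.
- apply (Hquot a da); auto; intros t; rewrite Nabs.
  pose proof (pow2_ge_0 (Rabs (a t) - Rabs (b t))); pose proof (pow2_ge_0 (Rabs (b t))).
  nra.
- apply (Hquot b db); auto; intros t; rewrite Nabs.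
  pose proof (pow2_ge_0 (Rabs (a t) - Rabs (b t))); pose proof (pow2_ge_0 (Rabs (a t))).
  nra.
Qed.

Definition stereo_den (z : C) : R := 1 + (Re z ^ 2 + Im z ^ 2).

(** On the segment from [z] to [w] the weight [1 - |y|^2] is at least [(1 - |z|) / 2], and the
    segment has length at most [5 / 2 * p * (1 - |z|)]. The image curve therefore has spherical
    speed at most [5 * K * p], and the stereographic coordinates multiply this by 4. *)
Lemma normal_lipschitz (f h g : C -> C) (K : R) (z w : C) :
  harmonic_mapping f h g ->
  (forall x, in_disc x -> (1 - Cmod x ^ 2) * fsharp f h g x <= K) ->
  in_disc z -> in_disc w -> pseudo_hyp z w <= / 5 ->
  let L := 20 * K * pseudo_hyp z w in
  Rabs (/ stereo_den (f w) - / stereo_den (f z)) <= L /\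
  Rabs (Re (f w) / stereo_den (f w) - Re (f z) / stereo_den (f z)) <= L /\
  Rabs (Im (f w) / stereo_den (f w) - Im (f z) / stereo_den (f z)) <= L.
Proof.
intros (Hh & Hg & Hf) HK Hz Hw Hp L.
pose proof (pseudo_hyp_range z w Hz Hw) as Hr.
pose proof (Cmod_minus_le_pseudo_hyp z w Hz Hw Hp) as Hv.
unfold L; set (p := pseudo_hyp z w) in *; set (v := (w - z)%C) in *.
set (y := fun t : R => (z + t * v)%C).
pose proof (Cmod_ge_0 v) as Hv0; pose proof (Cmod_ge_0 z) as Hz0.
assert (Hz1 : Cmod z < 1) by exact Hz.
assert (Hy : forall t, 0 <= t <= 1 -> Cmod (y t) <= 1 - (1 - Cmod z) / 2).
{ intros t Ht; unfold y; eapply Rle_trans; [apply Cmod_triangle|].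
  rewrite Cmod_mult, Cmod_R, Rabs_pos_eq by lra.
  assert (Cmod v <= (1 - Cmod z) / 2) by nra.
  nra. }
assert (Hyd : forall t, 0 <= t <= 1 -> in_disc (y t)).
{ intros t Ht; specialize (Hy t Ht); unfold in_disc; lra. }
set (dh := fun t => C_derive h (y t)); set (dg := fun t => C_derive g (y t)).
assert (Dh : forall t, 0 <= t <= 1 -> @is_derive C_AbsRing C_NormedModule h (y t) (dh t)).
{ intros t Ht; apply C_derive_correct; [exact (RtoC 0)|auto]. }
assert (Dg : forall t, 0 <= t <= 1 -> @is_derive C_AbsRing C_NormedModule g (y t) (dg t)).
{ intros t Ht; apply C_derive_correct; [exact (RtoC 0)|auto]. }
assert (Ref : forall t, 0 <= t <= 1 -> Re (f (y t)) = Re (h (y t)) + Re (g (y t))).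
{ intros t Ht; rewrite Hf by auto; reflexivity. }
assert (Imf : forall t, 0 <= t <= 1 -> Im (f (y t)) = Im (h (y t)) - Im (g (y t))).
{ intros t Ht; rewrite Hf by auto; reflexivity. }
assert (DRe : forall k d t, @is_derive C_AbsRing C_NormedModule k (y t) d ->
  is_derive (fun s => Re (k (y s))) t (Re (v * d)%C)).
{ intros k d t Hd; apply is_derive_along_line; auto.
  - intros s [x x']; simpl; ring.
  - exact re_le_Cmod. }
assert (DIm : forall k d t, @is_derive C_AbsRing C_NormedModule k (y t) d ->
  is_derive (fun s => Im (k (y s))) t (Im (v * d)%C)).
{ intros k d t Hd; apply is_derive_along_line; auto.
  - intros s [x x']; simpl; ring.
  - exact Im_le_Cmod. }
assert (Bd : forall t, 0 <= t <= 1 ->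
  Cmod v * (Cmod (dh t) + Cmod (dg t)) <=
  5 * K * p * (1 + ((Re (h (y t)) + Re (g (y t))) ^ 2 + (Im (h (y t)) - Im (g (y t))) ^ 2))).
{ intros t Ht; rewrite <- Ref, <- Imf by exact Ht; rewrite <- Cmod2_alt.
  specialize (HK (y t) (Hyd t Ht)); specialize (Hy t Ht); unfold fsharp in HK.
  fold (dh t) (dg t) in HK.
  set (S := Cmod (dh t) + Cmod (dg t)) in *.
  set (N := 1 + Cmod (f (y t)) ^ 2) in *.
  assert (HS : 0 <= S) by (unfold S; pose proof (Cmod_ge_0 (dh t)); pose proof (Cmod_ge_0 (dg t)); lra).
  assert (HN : 0 < N) by (unfold N; pose proof (pow2_ge_0 (Cmod (f (y t)))); lra).
  pose proof (Cmod_ge_0 (y t)) as Hy0.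
  assert (HS' : 0 <= S / N) by now apply Rdiv_le_0_compat.
  replace S with (S / N * N) by (field; lra).
  set (s := S / N) in *.
  assert (H1 : (1 - Cmod z) / 2 * s <= K).
  { eapply Rle_trans; [|exact HK]; apply Rmult_le_compat_r; [exact HS'|]; nra. }
  assert (H2 : Cmod v * s <= 5 * K * p).
  { apply Rle_trans with (5 / 2 * p * (1 - Cmod z) * s).
    - now apply Rmult_le_compat_r.
    - replace (5 / 2 * p * (1 - Cmod z) * s) with (5 * p * ((1 - Cmod z) / 2 * s)) by field.
      nra. }
  nra. }
destruct (stereographic_lipschitz
  (fun t => Re (h (y t)) + Re (g (y t))) (fun t => Im (h (y t)) - Im (g (y t)))
  (fun t => Re (v * dh t)%C + Re (v * dg t)%C) (fun t => Im (v * dh t)%C - Im (v * dg t)%C)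
  (5 * K * p)) as (C1 & C2 & C3).
- intros t Ht; apply (is_derive_plus (V := R_NormedModule)); auto.
- intros t Ht; apply (is_derive_minus (V := R_NormedModule)); auto.
- intros t Ht; eapply Rle_trans; [|exact (Bd t Ht)].
  eapply Rle_trans; [apply Rabs_triang|].
  pose proof (re_le_Cmod (v * dh t)); pose proof (re_le_Cmod (v * dg t)).
  rewrite Cmod_mult in *; lra.
- intros t Ht; eapply Rle_trans; [|exact (Bd t Ht)].
  eapply Rle_trans; [apply Rabs_triang|]; rewrite Rabs_Ropp.
  pose proof (Im_le_Cmod (v * dh t)); pose proof (Im_le_Cmod (v * dg t)).
  rewrite Cmod_mult in *; lra.
- rewrite <- !Ref, <- !Imf in C1, C2, C3 by lra.
  replace (y 1) with w in * by (unfold y, v; ring).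
  replace (y 0) with z in * by (unfold y, v; ring).
  unfold stereo_den; repeat split; lra.
Qed.

Lemma is_lim_seq_shadow (u v e : nat -> R) (l : R) :
  is_lim_seq u l -> is_lim_seq e 0 ->
  eventually (fun n => Rabs (v n - u n) <= e n) -> is_lim_seq v l.
Proof.
intros Hu He Hv.
apply (is_lim_seq_ext (fun n => (v n - u n) + u n)); [intros n; ring|].
replace l with (0 + l) by ring.
apply is_lim_seq_plus'; [|exact Hu].
apply is_lim_seq_abs_0.
apply (is_lim_seq_le_le_loc (fun _ => 0) _ e); [|apply is_lim_seq_const|exact He].
destruct Hv as [N HN]; exists N; intros n Hn; split; [apply Rabs_pos|auto].
Qed.

Lemma normal_bound (f h g : C -> C) : normal_in_disc f h g ->
  exists K, forall x, in_disc x -> (1 - Cmod x ^ 2) * fsharp f h g x <= K.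
Proof.
unfold normal_in_disc; intros H.
match type of H with Rbar_lt (Lub_Rbar ?E) _ =>
  destruct (Lub_Rbar_correct E) as [U _]; destruct (Lub_Rbar E) as [K| |] end.
- exists K; intros x Hx; apply (U _); exists x; auto.
- contradiction.
(* [m_infty] cannot bound a real value from above, so the witness is arbitrary. *)
- exists 0; intros x Hx.
  destruct (U ((1 - Cmod x ^ 2) * fsharp f h g x)); exists x; auto.
Qed.

Lemma stereo_den_pos (z : C) : 0 < stereo_den z.
Proof. unfold stereo_den; pose proof (pow2_ge_0 (Re z)); pose proof (pow2_ge_0 (Im z)); lra. Qed.

(** For finite [l] the limit of [1 / N] is positive, where [N] is [stereo_den]; hence [Re] and [Im]
    are recovered by dividing the limits of [Re / N] and [Im / N] by it. *)
Lemma normal_seq_limits (f h g : C -> C) (z w : nat -> C) (l : C) :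
  harmonic_mapping f h g -> normal_in_disc f h g ->
  (forall n, in_disc (z n)) -> (forall n, in_disc (w n)) ->
  is_lim_seq (fun n => pseudo_hyp (z n) (w n)) 0 ->
  C_seq_lim (fun n => f (z n)) l -> C_seq_lim (fun n => f (w n)) l.
Proof.
intros Hf Hnorm Hz Hw Hp Hl.
destruct (normal_bound f h g Hnorm) as [K HK].
apply C_seq_lim_Re_Im in Hl; destruct Hl as [HRe HIm].
assert (He : is_lim_seq (fun n => 20 * K * pseudo_hyp (z n) (w n)) 0).
{ replace 0 with (20 * K * 0) by ring.
  apply (is_lim_seq_scal_l _ (20 * K) 0), Hp. }
assert (Hev : eventually (fun n => pseudo_hyp (z n) (w n) <= / 5)).
{ destruct (proj1 (is_lim_seq_Reals_iff _ _) Hp (/ 5) ltac:(lra)) as [N HN].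
  exists N; intros n Hn; specialize (HN n Hn); rewrite Rminus_0_r in HN.
  pose proof (Rle_abs (pseudo_hyp (z n) (w n))); lra. }
assert (HD : is_lim_seq (fun n => stereo_den (f (z n))) (stereo_den l)).
{ unfold stereo_den; apply is_lim_seq_plus'; [apply is_lim_seq_const|].
  simpl; apply is_lim_seq_plus'; repeat apply is_lim_seq_mult'; auto; apply is_lim_seq_const. }
pose proof (stereo_den_pos l) as Hl0.
assert (HI : is_lim_seq (fun n => / stereo_den (f (w n))) (/ stereo_den l)).
{ apply (is_lim_seq_shadow (fun n => / stereo_den (f (z n))) _ _ _) with (2 := He).
  - apply (is_lim_seq_inv _ (stereo_den l)); [exact HD|]; intros E; injection E; lra.
  - destruct Hev as [N HN]; exists N; intros n Hn.
    now apply (normal_lipschitz f h g K (z n) (w n)); auto. }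
assert (Hback : forall q : C -> R,
  is_lim_seq (fun n => q (f (w n)) / stereo_den (f (w n))) (q l / stereo_den l) ->
  is_lim_seq (fun n => q (f (w n))) (q l)).
{ intros q Hq.
  replace (q l) with ((q l / stereo_den l) / (/ stereo_den l)) by (field; lra).
  apply (is_lim_seq_ext (fun n => (q (f (w n)) / stereo_den (f (w n))) / (/ stereo_den (f (w n))))).
  - intros n; pose proof (stereo_den_pos (f (w n))); field; lra.
  - apply is_lim_seq_div'; auto.
    pose proof (Rinv_0_lt_compat _ Hl0); lra. }
apply C_seq_lim_Re_Im; split.
- apply (Hback Re).
  apply (is_lim_seq_shadow (fun n => Re (f (z n)) / stereo_den (f (z n))) _ _ _) with (2 := He).
  + apply is_lim_seq_div'; auto; lra.
  + destruct Hev as [N HN]; exists N; intros n Hn.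
    now apply (normal_lipschitz f h g K (z n) (w n)); auto.
- apply (Hback Im).
  apply (is_lim_seq_shadow (fun n => Im (f (z n)) / stereo_den (f (z n))) _ _ _) with (2 := He).
  + apply is_lim_seq_div'; auto; lra.
  + destruct Hev as [N HN]; exists N; intros n Hn.
    now apply (normal_lipschitz f h g K (z n) (w n)); auto.
Qed.

(** * The limit condition implies normality *)

(** Failure for each radius [1 / (n + 1)] yields sequences with [f (z n)] tending to [l], hence also
    [f (w n)], although the two stay at distance at least 1. Closeness to [l] is measured by
    coordinates to suit the compactness of a square. *)
Lemma seq_limits_local (f : C -> C) (l : C) :
  (forall z w : nat -> C, (forall n, in_disc (z n)) -> (forall n, in_disc (w n)) ->
     is_lim_seq (fun n => pseudo_hyp (z n) (w n)) 0 ->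
     C_seq_lim (fun n => f (z n)) l -> C_seq_lim (fun n => f (w n)) l) ->
  exists r : posreal, forall z w : C, in_disc z -> in_disc w ->
    pseudo_hyp z w < r -> Rabs (Re (f z) - Re l) < r -> Rabs (Im (f z) - Im l) < r ->
    Cmod (f w - f z) < 1.
Proof.
intros Hseq.
destruct (classic (exists r : posreal, forall z w : C, in_disc z -> in_disc w ->
    pseudo_hyp z w < r -> Rabs (Re (f z) - Re l) < r -> Rabs (Im (f z) - Im l) < r ->
    Cmod (f w - f z) < 1)) as [H|H]; [exact H|exfalso].
assert (Hbad : forall n : nat, exists zw : C * C, in_disc (fst zw) /\ in_disc (snd zw) /\
  pseudo_hyp (fst zw) (snd zw) < / (INR n + 1) /\
  Rabs (Re (f (fst zw)) - Re l) < / (INR n + 1) /\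
  Rabs (Im (f (fst zw)) - Im l) < / (INR n + 1) /\
  1 <= Cmod (f (snd zw) - f (fst zw))).
{ intros n; apply NNPP; intros Hn; apply H.
  exists (mkposreal _ (RinvN_pos n)); simpl; intros z w Hz Hw H1 H2 H3.
  apply Rnot_le_lt; intros H4; apply Hn; exists (z, w); auto 10. }
destruct (functional_choice _ Hbad) as [zw Hzw].
assert (Hsqueeze : forall u : nat -> R,
  (forall n, Rabs (u n) <= / (INR n + 1)) -> is_lim_seq u 0).
{ intros u Hu; apply is_lim_seq_abs_0.
  apply (is_lim_seq_le_le (fun _ => 0) _ (fun n => / (INR n + 1))).
  - intros n; split; [apply Rabs_pos|apply Hu].
  - apply is_lim_seq_const.
  - apply (is_lim_seq_inv _ p_infty); [|discriminate].
    apply (is_lim_seq_plus _ _ p_infty 1); [apply is_lim_seq_INR|apply is_lim_seq_const|reflexivity]. }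
assert (Hfz : C_seq_lim (fun n => f (fst (zw n))) l).
{ apply C_seq_lim_Re_Im; split.
  - apply (is_lim_seq_ext (fun n => (Re (f (fst (zw n))) - Re l) + Re l)); [intros; ring|].
    replace (Finite (Re l)) with (Finite (0 + Re l)) by (f_equal; ring).
    apply is_lim_seq_plus'; [|apply is_lim_seq_const].
    apply Hsqueeze; intros n; left; apply Hzw.
  - apply (is_lim_seq_ext (fun n => (Im (f (fst (zw n))) - Im l) + Im l)); [intros; ring|].
    replace (Finite (Im l)) with (Finite (0 + Im l)) by (f_equal; ring).
    apply is_lim_seq_plus'; [|apply is_lim_seq_const].
    apply Hsqueeze; intros n; left; apply Hzw. }
assert (Hfw : C_seq_lim (fun n => f (snd (zw n))) l).
{ apply (Hseq (fun n => fst (zw n)) (fun n => snd (zw n))); auto.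
  - intros n; apply Hzw.
  - intros n; apply Hzw.
  - apply Hsqueeze; intros n; destruct (Hzw n) as (Hz & Hw & Hp & _).
    rewrite Rabs_pos_eq; [lra|apply pseudo_hyp_range; auto]. }
destruct (proj1 (C_seq_lim_iff _ _) Hfz (/ 2) ltac:(lra)) as [N1 HN1].
destruct (proj1 (C_seq_lim_iff _ _) Hfw (/ 2) ltac:(lra)) as [N2 HN2].
specialize (HN1 (max N1 N2) ltac:(lia)); specialize (HN2 (max N1 N2) ltac:(lia)).
destruct (Hzw (max N1 N2)) as (_ & _ & _ & _ & _ & Hge).
set (z := fst (zw (max N1 N2))) in *; set (w := snd (zw (max N1 N2))) in *.
replace (f w - f z)%C with ((f w - l) + - (f z - l))%C in Hge by ring.
pose proof (Cmod_triangle (f w - l) (- (f z - l))) as T.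
rewrite Cmod_opp in T; lra.
Qed.

Lemma seq_limits_uniform (f : C -> C) :
  (forall z w : nat -> C, (forall n, in_disc (z n)) -> (forall n, in_disc (w n)) ->
     is_lim_seq (fun n => pseudo_hyp (z n) (w n)) 0 -> forall l,
     C_seq_lim (fun n => f (z n)) l -> C_seq_lim (fun n => f (w n)) l) ->
  forall B : R, exists delta : R, 0 < delta /\
    forall z w : C, in_disc z -> in_disc w -> pseudo_hyp z w < delta ->
      Cmod (f z) <= B -> Cmod (f w) <= B + 1.
Proof.
intros Hseq B.
destruct (functional_choice (fun (l : C) (r : posreal) => forall z w : C, in_disc z -> in_disc w ->
    pseudo_hyp z w < r -> Rabs (Re (f z) - Re l) < r -> Rabs (Im (f z) - Im l) < r ->
    Cmod (f w - f z) < 1)) as [rad Hrad].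
{ intros l; apply seq_limits_local; intros z w Hz Hw Hp; exact (Hseq z w Hz Hw Hp l). }
(* The square contains the closed ball of radius [B]. Each of its points is within [rad (u, v)], in
   both coordinates, of some centre [(u, v)] with [delta <= rad (u, v)]; this comes under a double
   negation. *)
destruct (compactness_value_2d (- B) B (- B) B (fun u v => rad (u, v))) as [delta Hdelta].
exists delta; split; [apply cond_pos|]; intros z w Hz Hw Hp HB.
pose proof (re_le_Cmod (f z)) as H1; pose proof (Im_le_Cmod (f z)) as H2.
destruct (NNPP _ (Hdelta (Re (f z)) (Im (f z)) ltac:(apply Rabs_le_between; lra)
  ltac:(apply Rabs_le_between; lra))) as (u & v & _ & _ & Hu & Hv & Hd).
assert (H3 : Cmod (f w - f z) < 1) by (apply (Hrad (u, v)); simpl; auto; lra).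
replace (f w) with ((f w - f z) + f z)%C by ring.
eapply Rle_trans; [apply Cmod_triangle|]; lra.
Qed.

(** [f] enters only through its modulus, so the statement can also be applied with [h] and [g]
    exchanged. *)
Lemma spherical_derivative_bound (f h g : C -> C) (M : R) :
  analytic_in_disc h -> analytic_in_disc g ->
  (forall z, in_disc z -> Cmod (g z) <= M) ->
  (forall z, in_disc z -> Cmod (h z) <= Cmod (f z) + M /\ Cmod (f z) <= Cmod (h z) + M) ->
  (forall B : R, exists delta : R, 0 < delta /\
    forall z w : C, in_disc z -> in_disc w -> pseudo_hyp z w < delta ->
      Cmod (f z) <= B -> Cmod (f w) <= B + 1) ->
  exists K, forall z, in_disc z -> (1 - Cmod z ^ 2) * fsharp f h g z <= K.
Proof.
intros Hh Hg HgM Hfh Hunif.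
assert (HM : 0 <= M).
{ eapply Rle_trans; [apply Cmod_ge_0|apply (HgM 0)]; unfold in_disc; rewrite Cmod_0; lra. }
destruct (Hunif (M + 1)) as [d1 [P1 D1]]; destruct (Hunif (M + 2)) as [d2 [P2 D2]].
(* The half gives strict inequalities on the closed ball of radius [r] below, and [delta <= / 2]
   keeps that ball in the disc. *)
set (delta := Rmin 1 (Rmin d1 d2) / 2).
assert (Hd : 0 < delta /\ delta <= / 2 /\ delta < d1 /\ delta < d2).
{ pose proof (Rmin_l 1 (Rmin d1 d2)); pose proof (Rmin_r 1 (Rmin d1 d2)).
  pose proof (Rmin_l d1 d2); pose proof (Rmin_r d1 d2).
  assert (0 < Rmin 1 (Rmin d1 d2)) by (repeat apply Rmin_glb_lt; lra).
  unfold delta; repeat split; lra. }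
clearbody delta; destruct Hd as (Hd0 & Hdh & Hd1 & Hd2).
(* [2 / delta] comes from [1 - |z|^2 <= 2 (1 - |z|)] and [r = delta (1 - |z|)]; the polynomial adds
   the contribution [2 * (2 * M ^ 2 + 2 * M + 5)] of [h] and the contribution [2 * M] of [g]. *)
exists (2 / delta * (4 * M ^ 2 + 6 * M + 10)); intros z Hz.
assert (Hz1 : Cmod z < 1) by exact Hz.
pose proof (Cmod_ge_0 z) as Hz0.
set (r := delta * (1 - Cmod z)).
assert (Hr : 0 < r) by (apply Rmult_lt_0_compat; lra).
assert (Hball : forall w, Cmod (w - z) <= r ->
  in_disc w /\ pseudo_hyp z w <= delta /\ pseudo_hyp w z <= delta).
{ intros w Hw.
  assert (Hwd : in_disc w).
  { unfold in_disc; replace w with (z + (w - z))%C by ring.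
    eapply Rle_lt_trans; [apply Cmod_triangle|]; unfold r in Hw; nra. }
  assert (Hp : pseudo_hyp z w <= delta).
  { apply pseudo_hyp_le; auto; [lra|].
    replace (z - w)%C with (- (w - z))%C by ring; rewrite Cmod_opp; exact Hw. }
  rewrite (pseudo_hyp_sym z w) by assumption; auto. }
assert (Hderiv : forall k, analytic_in_disc k ->
  @is_derive C_AbsRing C_NormedModule k z (C_derive k z)).
{ intros k Hk; apply C_derive_correct; [exact (RtoC 0)|auto]. }
assert (Hon : forall k, analytic_in_disc k ->
  C_derivable_on k (fun w => Cmod (w - z) <= r)).
{ intros k Hk w Hw; exact (Hk w (proj1 (Hball w Hw))). }
assert (Eg : Cmod (C_derive g z) <= 2 * M / r).
{ apply (cauchy_estimate g z _ r M); auto.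
  intros w Hw; apply HgM, Hball, Hw. }
set (N := 1 + Cmod (f z) ^ 2).
assert (HN : 1 <= N) by (unfold N; pose proof (pow2_ge_0 (Cmod (f z))); lra).
(* The constant covers both cases: [2 * M + 3], which bounds [|h|] near [z] when [f z] is small, and
   [2 * M ^ 2 + 2], for which [|h z|^2 <= (2 * M ^ 2 + 2) * N]. *)
assert (Eh : Cmod (C_derive h z) <= 2 * (2 * M ^ 2 + 2 * M + 5) * N / r).
{ destruct (Rle_lt_dec (Cmod (f z)) (M + 2)) as [Hsmall|Hbig].
  - apply Rle_trans with (2 * (2 * M + 3) / r).
    + apply (cauchy_estimate h z _ r (2 * M + 3)); auto.
      intros w Hw; destruct (Hball w Hw) as (Hwd & Hp & _).
      pose proof (D2 z w Hz Hwd ltac:(lra) Hsmall); pose proof (proj1 (Hfh w Hwd)); lra.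
    + apply Rmult_le_compat_r; [left; now apply Rinv_0_lt_compat|].
      pose proof (pow2_ge_0 M); nra.
  - assert (Hlow : forall w, Cmod (w - z) <= r -> 1 < Cmod (h w)).
    { intros w Hw; destruct (Hball w Hw) as (Hwd & _ & Hp).
      pose proof (proj2 (Hfh w Hwd)).
      destruct (Rle_lt_dec (Cmod (f w)) (M + 1)) as [Hle|Hlt]; [|lra].
      pose proof (D1 w z Hwd Hz ltac:(lra) Hle); lra. }
    assert (Hne : forall w, Cmod (w - z) <= r -> h w <> 0%C).
    { intros w Hw; apply Cmod_gt_0; specialize (Hlow w Hw); lra. }
    assert (Hzz : Cmod (z - z) <= r) by (replace (z - z)%C with (RtoC 0) by ring; rewrite Cmod_0; lra).
    pose proof (Hne z Hzz) as Hz2; pose proof (Hlow z Hzz) as Hz3.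
    (* The derivative of [1/h] is [- h' / h^2], so the bound 1 on [1/h] gives [|h'| <= 2 |h|^2 / r];
       this square is what [1 + |f|^2] compensates. *)
    pose proof (cauchy_estimate (fun w => / h w)%C z
      (C_derive h z * - / (h z * h z))%C r 1 Hr) as E.
    assert (E' : Cmod (C_derive h z * - / (h z * h z)) <= 2 * 1 / r).
    { apply E.
      - intros w Hw; destruct (Hon h Hh w Hw) as [e He].
        eexists; apply (is_derive_C_comp Cinv h); [apply is_derive_Cinv, Hne, Hw|exact He].
      - intros w Hw; rewrite Cmod_inv by auto; specialize (Hlow w Hw).
        rewrite <- Rinv_1; apply Rinv_le_contravar; lra.
      - apply (is_derive_C_comp Cinv h); [now apply is_derive_Cinv|auto]. }
    rewrite Cmod_mult, Cmod_opp, Cmod_inv, Cmod_mult in E' by now apply Cmult_neq_0.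
    apply (Rmult_le_compat_r (Cmod (h z) * Cmod (h z))) in E'; [|nra].
    rewrite Rmult_assoc, Rinv_l, Rmult_1_r in E' by nra.
    eapply Rle_trans; [exact E'|].
    replace (2 * 1 / r * (Cmod (h z) * Cmod (h z))) with (2 * Cmod (h z) ^ 2 / r)
      by (field; lra).
    apply Rmult_le_compat_r; [left; now apply Rinv_0_lt_compat|].
    pose proof (proj1 (Hfh z Hz)).
    assert (Cmod (h z) ^ 2 <= (Cmod (f z) + M) ^ 2) by (apply pow_incr; lra).
    assert ((Cmod (f z) + M) ^ 2 <= 2 * Cmod (f z) ^ 2 + 2 * M ^ 2)
      by (pose proof (pow2_ge_0 (Cmod (f z) - M)); nra).
    assert (2 * Cmod (f z) ^ 2 + 2 * M ^ 2 <= (2 * M ^ 2 + 2) * N).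
    { unfold N; pose proof (pow2_ge_0 M); pose proof (pow2_ge_0 (Cmod (f z))); nra. }
    nra. }
unfold fsharp; fold N.
assert (Hsum : Cmod (C_derive h z) + Cmod (C_derive g z) <=
  (4 * M ^ 2 + 6 * M + 10) * N / r).
{ assert (2 * M / r <= 2 * M * N / r).
  { apply Rmult_le_compat_r; [left; now apply Rinv_0_lt_compat|]; nra. }
  replace ((4 * M ^ 2 + 6 * M + 10) * N / r) with
    (2 * (2 * M ^ 2 + 2 * M + 5) * N / r + 2 * M * N / r) by (field; lra).
  lra. }
assert (Hw : 0 < 1 - Cmod z ^ 2 <= 2 * (1 - Cmod z)) by (split; nra).
apply Rle_trans with (2 * (1 - Cmod z) * ((4 * M ^ 2 + 6 * M + 10) * N / r / N)).
- apply Rmult_le_compat; try lra.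
  + apply Rdiv_le_0_compat; [|lra].
    pose proof (Cmod_ge_0 (C_derive h z)); pose proof (Cmod_ge_0 (C_derive g z)); lra.
  + apply Rmult_le_compat_r; [left; apply Rinv_0_lt_compat; lra|exact Hsum].
- right; unfold r; field; lra.
Qed.

Theorem theorem4 (f h g : C -> C)
  (Hf : harmonic_mapping f h g)
  (Hbd : bounded_in_disc h \/ bounded_in_disc g) :
  normal_in_disc f h g <->
  (forall z w : nat -> C,
     (forall n : nat, in_disc (z n)) ->
     (forall n : nat, in_disc (w n)) ->
     is_lim_seq (fun n : nat => hyp_dist (z n) (w n)) 0 ->
     forall l : C,
       C_seq_lim (fun n : nat => f (z n)) l ->
       C_seq_lim (fun n : nat => f (w n)) l).
Proof.
split.
- intros Hn z w Hz Hw Hzw l Hl.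
  apply (normal_seq_limits f h g z w l); auto.
  now apply is_lim_seq_hyp_dist.
- intros Hseq.
  assert (Hunif := seq_limits_uniform f (fun z w Hz Hw Hp =>
    Hseq z w Hz Hw (proj2 (is_lim_seq_hyp_dist z w Hz Hw) Hp))).
  destruct Hf as (Hh & Hg & Hfeq).
  assert (HK : exists K, forall z, in_disc z -> (1 - Cmod z ^ 2) * fsharp f h g z <= K).
  { destruct Hbd as [[M HM]|[M HM]].
    (* When [h] is the bounded part, the roles are exchanged: [|f|] and [|g|] differ by at most [M],
       and [fsharp] is symmetric in [h] and [g]. *)
    - destruct (spherical_derivative_bound f g h M) as [K HK]; auto.
      + intros z Hz; specialize (HM z Hz); rewrite (Hfeq z Hz).
        rewrite <- (Cmod_conj (g z)); split.
        * replace (Cconj (g z)) with ((h z + Cconj (g z)) + - h z)%C at 1 by ring.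
          eapply Rle_trans; [apply Cmod_triangle|]; rewrite Cmod_opp; lra.
        * eapply Rle_trans; [apply Cmod_triangle|]; lra.
      + exists K; intros z Hz; specialize (HK z Hz).
        unfold fsharp in *; now rewrite (Rplus_comm (Cmod (C_derive h z))).
    - apply (spherical_derivative_bound f h g M); auto.
      intros z Hz; specialize (HM z Hz); rewrite (Hfeq z Hz).
      rewrite <- (Cmod_conj (g z)) in HM; split.
      + replace (h z) with ((h z + Cconj (g z)) + - Cconj (g z))%C at 1 by ring.
        eapply Rle_trans; [apply Cmod_triangle|]; rewrite Cmod_opp; lra.
      + eapply Rle_trans; [apply Cmod_triangle|]; lra. }
  destruct HK as [K HK]; unfold normal_in_disc.
  apply (Rbar_le_lt_trans _ (Finite K)); [|exact I].
  apply Lub_Rbar_correct; intros x [z [Hz ->]]; now apply HK.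
Qed.
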